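(* For any $L\ge\mu>0$ with $L>24\mu$, and any $\alpha>0$, $c>0$, there exists an $L$-smooth $\mu$-strongly convex decentralized problem $\mathcal{DP}$ with sufficiently large $\chi(\mathcal{DP})=\chi$ and $n(\mathcal{DP})=n$ (i.e. larger than any prescribed bound), such that $\Delta(\mathcal{DP})\le c\,n^{\alpha}$ and, for any first-order decentralized algorithm, the number of communication rounds needed to find an $\varepsilon$-accurate solution of $\min_x f(x)$ is lower bounded by $$\Omega\left(\chi\sqrt{L/\mu}\,\log\frac1\varepsilon\right).$$
   Context: $\mathbb{N}=\{1,2,\dots\}$. All objective functions are defined on the Hilbert space $\ell_2$ with its usual norm $\|\cdot\|$. A differentiable function $h$ is $L$-smooth if $\|\nabla h(y)-\nabla h(x)\|\le L\|y-x\|$ for all $x,y$, and $\mu$-strongly convex if $h(y)\ge h(x)+\langle\nabla h(x),y-x\rangle+\frac{\mu}{2}\|y-x\|^2$ for all $x,y$. Decentralized problem. A decentralized time-varying problem $\mathcal{DP}$ is a pair $(\{\mathcal G_k\}_{k=1}^\infty,\{f_i\}_{i=1}^n)$, where $\mathcal G_k=(\mathcal V,\mathcal E_k)$ are undirected connected graphs on the common vertex set $\mathcal V=\{1,\dots,n\}$, and $f_i$ is a convex function with Lipschitz gradient held by node $i$. Set $f(x)=\frac1n\sum_{i=1}^n f_i(x)$ (the global function); $\mathcal{DP}$ is called $L$-smooth (resp. $\mu$-strongly convex) if $f$ is. Let $x_*$ denote the minimizer of $f$. Put $n(\mathcal{DP})=n$. For a connected graph $\mathcal G$, let $\chi(\mathcal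 G)=\lambda_{\max}/\lambda_{\min}^+$ be the ratio of the largest to the smallest nonzero eigenvalue of the graph Laplacian (degree matrix minus adjacency matrix) of $\mathcal G$, and put $\chi(\mathcal{DP})=\sup_k\chi(\mathcal G_k)$. Put $\Delta(\mathcal{DP})=\max_{k\in\mathbb N}|(\mathcal E_k\setminus\mathcal E_{k+1})\cup(\mathcal E_{k+1}\setminus\mathcal E_k)|$, the maximum number of edges changed between consecutive communication rounds. First-order decentralized algorithm. Each node $i$ has a local memory $\mathcal H_i(k)\subseteq\ell_2$ at time step $k=0,1,2,\dots$, with $\mathcal H_i(0)=\{x_0\}$, $x_0=0$. At each time step $k$ the algorithm performs one of the following. (1) A local computation: $\mathcal H_i(k+1)\subseteq\mathrm{span}\{x,\nabla f_i(x),\nabla f_i^*(x):x\in\mathcal H_i(k)\}$ for all $i$, where $f_i^*$ is the convex conjugate of $f_i$. (2) A communication round: $\mathcal H_i(k+1)\subseteq\mathrm{span}\big(\bigcup_{j\in\mathcal N_i^{q}\cup\{i\}}\mathcal H_j(k)\big)$ for all $i$, where this is the $q$-th communication round performed and $\mathcal N_i^{q}$ is the set of neighbors of $i$ in $\mathcal G_q$. An $\varepsilon$-accurate solution is a point $x$ (in the memory of some node) with $\|x-x_*\|^2\le\varepsilon$. The notation $\Omega(\cdot)$ is asymptotic as $\varepsilon\to0$ (for all sufficiently small $\varepsilon$), with a hidden positive constant depending only on $\alpha$ and $c$. *)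

(* Defs.v *)
From HB Require Import structures.
From mathcomp Require Import all_boot all_order all_algebra.
From mathcomp Require Import all_classical all_reals all_analysis.
From mathcomp Require Import ring lra.

Set Implicit Arguments.
Unset Strict Implicit.
Unset Printing Implicit Defensive.

Import Order.TTheory GRing.Theory Num.Theory.
Import numFieldNormedType.Exports.

Local Open Scope classical_set_scope.
Local Open Scope ring_scope.

Definition square_summable {R : realType} : {pred nat -> R^o} :=
  fun u => `[< cvgn (series (fun k => u k ^+ 2)) >].

Record ell2 (R : realType) := Ell2 {
  ell2_seq :> nat -> R^o;
  ell2_seqP : ell2_seq \in @square_summable R
}.

Section Ell2.
Context (R : realType).
Implicit Types u v w : nat -> R^o.

Lemma square_summableP u :
  reflect (cvgn (series (fun k => u k ^+ 2))) (u \in @square_summable R).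
Proof. exact: asboolP. Qed.

Lemma square_summable_submod : submod_closed (@square_summable R).
Proof.
split.
  apply/square_summableP.
  rewrite (_ : series _ = cst 0); first exact: is_cvg_cst.
  by apply/funext => n; rewrite /series/= big1// => i _; rewrite expr0n.
move=> a u v /square_summableP hu /square_summableP hv; apply/square_summableP.
apply: (@series_le_cvg _ _
  (fun k => (2 * a ^+ 2) *: (u k ^+ 2 : R^o) + 2 *: (v k ^+ 2 : R^o))).
- by move=> n; exact: sqr_ge0.
- by move=> n; rewrite addr_ge0// mulr_ge0// ?sqr_ge0// mulr_ge0// sqr_ge0.
- move=> n; rewrite /GRing.scale/= -subr_ge0.
  have -> : 2 * a ^+ 2 * u n ^+ 2 + 2 * v n ^+ 2 - (a * u n + v n) ^+ 2
          = (a * u n - v n) ^+ 2 by ring.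
  exact: sqr_ge0.
- by apply: (@is_cvg_seriesD _ ((2 * a ^+ 2) *: ((fun k => u k ^+ 2) : R^nat))
    (2 *: ((fun k => v k ^+ 2) : R^nat))); exact: is_cvg_seriesZ.
Qed.

HB.instance Definition _ :=
  GRing.isSubmodClosed.Build R (nat -> R^o) (@square_summable R)
    square_summable_submod.
HB.instance Definition _ := [isSub for @ell2_seq R].
HB.instance Definition _ := [Choice of ell2 R by <:].
HB.instance Definition _ := [SubChoice_isSubLmodule of ell2 R by <:].

Implicit Types x y z : ell2 R.

Definition dot x y : R := limn (series (fun k => x k * y k)).

Lemma is_cvg_dot x y : cvgn (series (fun k => x k * y k)).
Proof.
apply: normed_cvg.
have /square_summableP hx := ell2_seqP x.
have /square_summableP hy := ell2_seqP y.
apply: (@series_le_cvg _ _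
  ((fun k => x k ^+ 2) + (fun k => y k ^+ 2))).
- by move=> n; exact: normr_ge0.
- by move=> n; rewrite addr_ge0// sqr_ge0.
- move=> n /=; rewrite normrM -[leRHS]/(x n ^+ 2 + y n ^+ 2).
  rewrite -(real_normK (num_real (x n))) -(real_normK (num_real (y n))).
  have := sqr_ge0 (`|x n| - `|y n|); have := normr_ge0 (x n).
  by have := normr_ge0 (y n); nra.
- exact: is_cvg_seriesD.
Qed.

Lemma dotC x y : dot x y = dot y x.
Proof. by rewrite /dot; under eq_fun do rewrite mulrC. Qed.

Lemma dotDl x y z : dot (x + y) z = dot x z + dot y z.
Proof.
have := lim_seriesD (@is_cvg_dot x z) (@is_cvg_dot y z); rewrite /dot => <-.
by congr (limn (series _)); apply/funext => k; rewrite -mulrDl.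
Qed.

Lemma dotZl (a : R) x y : dot (a *: x) y = a * dot x y.
Proof.
rewrite /dot -[RHS](lim_seriesZ a (@is_cvg_dot x y)).
by congr (limn (series _)); apply/funext => k; rewrite /= -mulrA.
Qed.

Lemma dotDr x y z : dot x (y + z) = dot x y + dot x z.
Proof. by rewrite dotC dotDl !(dotC x). Qed.

Lemma dotZr (a : R) x y : dot x (a *: y) = a * dot x y.
Proof. by rewrite dotC dotZl dotC. Qed.

Lemma dot_ge_term x n : x n ^+ 2 <= dot x x.
Proof.
apply: (@le_trans _ _ (series (fun k => x k * x k) n.+1)).
  by rewrite /series/= big_nat_recr//= -expr2 lerDr sumr_ge0// => i _;
     rewrite -expr2 sqr_ge0.
apply: nondecreasing_cvgn_le; last exact: is_cvg_dot.
by apply/nondecreasing_seqP => k; rewrite /series/= big_nat_recr//= lerDl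
  -expr2 sqr_ge0.
Qed.

Lemma dot_ge0 x : 0 <= dot x x.
Proof. exact: le_trans (sqr_ge0 _) (dot_ge_term x 0). Qed.

Lemma dot_eq0 x : dot x x = 0 -> x = 0.
Proof.
move=> x0; apply/val_inj/funext => k.
have := dot_ge_term x k; rewrite x0 => h.
by apply/eqP; rewrite -sqrf_eq0 eq_le h sqr_ge0.
Qed.

Lemma cauchy_schwarz x y : dot x y ^+ 2 <= dot x x * dot y y.
Proof.
have [y0|y0] := eqVneq (dot y y) 0.
  by rewrite (dot_eq0 y0) -(scale0r y) !dotZr !mul0r mulr0 expr0n.
have yp : 0 < dot y y by rewrite lt_def y0 dot_ge0.
have := dot_ge0 (dot y y *: x + (- dot x y) *: y).
rewrite !(dotDl, dotDr, dotZl, dotZr) (dotC y x) => h.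
have : 0 <= dot y y * (dot x x * dot y y - dot x y ^+ 2) by nra.
by rewrite pmulr_rge0// subr_ge0.
Qed.

Definition ell2_norm x : R := Num.sqrt (dot x x).

Lemma ell2_normD x y : ell2_norm (x + y) <= ell2_norm x + ell2_norm y.
Proof.
rewrite /ell2_norm -(@ler_pXn2r _ 2)// ?nnegrE ?addr_ge0 ?sqrtr_ge0//.
rewrite sqrrD !sqr_sqrtr ?dot_ge0// !(dotDl, dotDr) (dotC y x).
rewrite -sqrtrM ?dot_ge0//.
have : dot x y <= Num.sqrt (dot x x * dot y y).
  apply: le_trans (ler_norm _) _.
  by rewrite -sqrtr_sqr ler_wsqrtr// cauchy_schwarz.
by rewrite mulr2n; lra.
Qed.

Lemma ell2_normZ (a : R) x : ell2_norm (a *: x) = `|a| * ell2_norm x.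
Proof.
by rewrite /ell2_norm dotZl dotZr mulrA -expr2 sqrtrM ?sqr_ge0// sqrtr_sqr.
Qed.

Lemma ell2_norm_eq0 x : ell2_norm x = 0 -> x = 0.
Proof.
move/eqP; rewrite sqrtr_eq0 => h; apply: dot_eq0.
by apply/eqP; rewrite eq_le h dot_ge0.
Qed.

HB.instance Definition _ :=
  Lmodule_isNormed.Build R (ell2 R) ell2_normD ell2_normZ ell2_norm_eq0.

End Ell2.

Section Functions.
Context (R : realType).
Implicit Types (h : ell2 R -> R^o) (x g : ell2 R).

(* Fréchet gradient, through the Riesz identification of ell2 with its dual *)
Definition is_gradient h x g : Prop := is_diff x h (dot g : ell2 R -> R^o).

Definition smooth (L : R) h : Prop :=
  exists2 grad : ell2 R -> ell2 R,
    forall x, is_gradient h x (grad x) & L.-lipschitz grad.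

Definition strongly_convex (mu : R) h : Prop :=
  exists2 grad : ell2 R -> ell2 R,
    forall x, is_gradient h x (grad x) &
    forall x y, h x + dot (grad x) (y - x) + mu / 2 * `|y - x| ^+ 2 <= h y.

Definition convex_conjugate h (y : ell2 R) : \bar R :=
  ereal_sup (range (fun x => (dot y x - h x)%:E)).

(* A conjugate may take the value +oo; it has a gradient only at points in
   the interior of its effective domain. *)
Definition is_egradient (F : ell2 R -> \bar R) x g : Prop :=
  (\forall y \near x, F y \is a fin_num) /\ is_gradient (fine \o F) x g.

Definition is_minimizer h x : Prop := forall y, h x <= h y.

End Functions.

(* The algebraic span: no topological closure is taken. *)
Definition lspan (R : realType) (V : lmodType R) (A : set V) : set V :=
  [set x | exists (m : nat) (a : 'I_m -> R) (v : 'I_m -> V),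
    (forall i, A (v i)) /\ x = \sum_(i < m) a i *: v i].

Record graph (n : nat) := Graph {
  adj :> rel 'I_n;
  adj_sym : symmetric adj;
  adj_irr : irreflexive adj
}.

Definition edges n (G : graph n) : {set {set 'I_n}} :=
  [set [set p.1; p.2] | p : 'I_n * 'I_n & G p.1 p.2]%SET.

Definition graph_connected n (G : graph n) : Prop :=
  forall i j, connect G i j.

Definition laplacian (R : realType) n (G : graph n) : 'M[R]_n :=
  diag_mx (\row_i #|G i|%:R) - \matrix_(i, j) (G i j)%:R.

Definition graph_chi (R : realType) n (G : graph n) : R :=
  sup [set a : R | eigenvalue (laplacian R G) a] /
  inf [set a : R | eigenvalue (laplacian R G) a /\ a != 0].

(* [dp_graph k] is the graph of the (k+1)-st communication round: rounds are
   counted from 0. *)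
Record problem (R : realType) := Problem {
  dp_n : nat;
  dp_graph : nat -> graph dp_n;
  dp_f : 'I_dp_n -> ell2 R -> R^o;
  dp_connected : forall k, graph_connected (dp_graph k);
  dp_convex : forall i, convex_function setT (dp_f i);
  dp_smooth : forall i, exists Li : R, smooth Li (dp_f i)
}.

Section Problem.
Context (R : realType) (DP : problem R).

Definition dp_global (x : ell2 R) : R^o :=
  (dp_n DP)%:R^-1 * \sum_(i < dp_n DP) dp_f i x.

(* The suprema below are over finite sets, there being finitely many graphs
   on [dp_n DP] vertices. *)
Definition dp_chi : R := sup (range (fun k => graph_chi R (dp_graph DP k))).

Definition edges_changed (k : nat) : nat :=
  let E := edges (dp_graph DP k) in
  let E' := edges (dp_graph DP k.+1) in
  #|(E :\: E') :|: (E' :\: E)|%SET.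

Definition dp_Delta : R := sup (range (fun k => (edges_changed k)%:R)).

(* [rounds comm k] communication rounds take place during the first k steps *)
Definition rounds (comm : nat -> bool) (k : nat) : nat := \sum_(t < k) comm t.

(* A run on the problem of an arbitrary first-order decentralized algorithm:
   [comm k] tells whether step k is a communication round, and [memory k i] is
   that of node i at time k. *)
Record first_order_run := FirstOrderRun {
  comm : nat -> bool;
  memory : nat -> 'I_(dp_n DP) -> set (ell2 R);
  memory0 : forall i, memory 0 i = [set 0];
  memory_local : forall k, ~~ comm k -> forall i,
    memory k.+1 i `<=`
      lspan [set g | exists2 x, memory k i x &
        [\/ g = x, is_gradient (dp_f i) x g |
            is_egradient (convex_conjugate (dp_f i)) x g]];
  memory_comm : forall k, comm k -> forall i,
    memory k.+1 i `<=`
      lspan (\bigcup_(j in [set j | j = i \/ dp_graph DP (rounds comm k) i j])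
        memory k j)
}.

End Problem.

(* Main.v *)
(* The graph of round r consists of two binary heaps whose roots are both joined
   to a bridge vertex t.  Its degrees are bounded, and a Hardy inequality on heaps
   gives a spectral gap of order 1/n, so chi is of order n.  The bridge sweeps the
   vertices back and forth, moving by one vertex per round, which changes a bounded
   number of edges.  The vertex it leaves behind joins the heap it moves away from,
   so during a sweep the left heap only gains vertices already reached by the news
   of the first vertex, or the right heap those reached by the news of the last:
   news needs a full sweep of n - 2 rounds to cross the network, and the answer
   needs the sweep back.

   The objective is Nesterov's chain on l2, split between the first and the last
   vertex so that each of them can extend the set of known coordinates by one only
   after hearing from the other.  Its minimizer is (q^k)_k with
   1 - q of order sqrt (mu / L), so that an error eps requires about
   sqrt (L / mu) * log (1 / eps) crossings. *)
From HB Require Import structures.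
Require Import Defs.
From mathcomp Require Import all_boot all_order all_algebra.
From mathcomp Require Import all_classical all_reals all_analysis.
From mathcomp Require Import zify ring lra.

Import Order.TTheory GRing.Theory Num.Theory.
Import numFieldNormedType.Exports.

Local Open Scope classical_set_scope.
Local Open Scope ring_scope.

Set Implicit Arguments.
Unset Strict Implicit.
Unset Printing Implicit Defensive.

(** * Hardy's inequality on a binary heap *)

Section Heap.
Context {R : realType}.
Implicit Types (F x : nat -> R) (N k : nat).

Lemma ler_sum_prefix F M N : (M <= N)%N -> (forall i, 0 <= F i) ->
  \sum_(0 <= i < M) F i <= \sum_(0 <= i < N) F i.
Proof.
move=> MN F0; rewrite [leRHS](@big_cat_nat _ _ _ M)//= lerDl.
by apply: sumr_ge0.
Qed.

Lemma sum_half_even F k :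
  \sum_(0 <= i < k.*2) F i./2 = 2 * \sum_(0 <= j < k) F j.
Proof.
elim: k => [|k IH]; first by rewrite !big_geq ?mulr0.
rewrite doubleS !big_nat_recr//= IH.
by rewrite doubleK uphalf_double; ring.
Qed.

(* Every node of a binary heap has at most two children. *)
Lemma sum_half F N : (forall i, 0 <= F i) ->
  \sum_(1 <= i < N.+1) F i./2 <= F 0 + 2 * \sum_(1 <= j < N./2.+1) F j.
Proof.
move=> F0.
have h : (N.+1 <= N./2.+1.*2)%N by lia.
have := ler_sum_prefix h (fun i => F0 i./2).
rewrite sum_half_even !(@big_ltn _ _ _ 0)//=; lra.
Qed.

Definition heap_energy x N : R := \sum_(1 <= i < N.+1) (x i - x i./2) ^+ 2.

Lemma heap_energy_ge0 x N : 0 <= heap_energy x N.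
Proof. by apply: sumr_ge0 => i _; exact: sqr_ge0. Qed.

Lemma heap_energy_le x M N : (M <= N)%N -> heap_energy x M <= heap_energy x N.
Proof.
move=> MN; rewrite /heap_energy [leRHS](@big_cat_nat _ _ _ M.+1)//= lerDl.
by apply: sumr_ge0 => i _; exact: sqr_ge0.
Qed.

(* Minkowski's inequality, written without square roots of the sums. *)
Lemma heap_minkowski x N (s t D : R) : x 0 = 0 -> 0 < s -> 0 < t -> t ^+ 2 = 2 ->
  heap_energy x N <= D ->
  \sum_(1 <= j < N./2.+1) x j ^+ 2 <= s ^+ 2 * D ->
  \sum_(1 <= i < N.+1) x i ^+ 2 <= (t * s + 1) ^+ 2 * D.
Proof.
move=> x0 s0 t0 t2 hE hS.
have ts0 : 0 < t * s by rewrite mulr_gt0.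
(* Young's inequality for [x i = d + a], with the weight [t * s] for which the two contributions add
   up to exactly [(t * s + 1) ^+ 2 * D]. *)
have h1 : \sum_(1 <= i < N.+1) x i ^+ 2 <=
  (1 + (t * s)^-1) * \sum_(1 <= i < N.+1) x i./2 ^+ 2 +
  (1 + t * s) * heap_energy x N.
  rewrite /heap_energy !mulr_sumr -big_split/=; apply: ler_sum => i _.
  set a := x i./2; rewrite -(subrK a (x i)); set d := x i - a.
  have -> : d + a - a = d by ring.
  have : 0 <= (t * s)^-1 * (a - (t * s) * d) ^+ 2.
    by rewrite mulr_ge0 ?sqr_ge0// invr_ge0 ltW.
  have -> : (t * s)^-1 * (a - (t * s) * d) ^+ 2 =
    (t * s)^-1 * a ^+ 2 - 2 * a * d + (t * s) * d ^+ 2.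
    by field; rewrite ?mulf_neq0 ?gt_eqF.
  nra.
have h2 := sum_half N (fun i => sqr_ge0 (x i)); rewrite x0 expr0n add0r in h2.
apply: (le_trans h1).
apply: (@le_trans _ _ ((1 + (t * s)^-1) * (2 * (s ^+ 2 * D)) + (1 + t * s) * D)).
  apply: lerD.
    apply: ler_wpM2l; first by rewrite addr_ge0// invr_ge0 ltW.
    by apply: (le_trans h2); rewrite ler_pM2l.
  by apply: ler_wpM2l => //; rewrite addr_ge0// ltW.
have -> : (1 + (t * s)^-1) * (2 * (s ^+ 2 * D)) =
  2 * s ^+ 2 * D + (t * s) * D.
  rewrite mulrDl mul1r -t2; field.
  by rewrite ?mulf_neq0 ?gt_eqF.
rewrite le_eqVlt; apply/orP; left; apply/eqP.
by rewrite -t2; ring.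
Qed.

(** Minkowski's inequality bounds the constant for M nodes by sqrt 2 times that for [M./2] nodes,
    plus 1. The constant thus grows like sqrt M, and its square linearly. *)
Lemma heap_hardy x N : x 0 = 0 ->
  \sum_(1 <= i < N.+1) x i ^+ 2 <= 12 * N%:R * heap_energy x N.
Proof.
move=> x0; pose t : R := Num.sqrt 2.
have t2 : t ^+ 2 = 2 by rewrite sqr_sqrtr.
have t0 : 0 < t by rewrite sqrtr_gt0.
have t1 : 1 < t by nra.
have t32 : t <= 3 / 2 by nra.
(* This closed form solves u(M) = t u(M/2) + 1 with u(1) = 1, and [- (1 + t)] is the fixed point of
   the recursion. The final 12 bounds [(2 + t) ^+ 2], which equals 6 + 4t. *)
suff H M : (0 < M <= N)%N -> \sum_(1 <= i < M.+1) x i ^+ 2 <=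
    ((2 + t) * Num.sqrt M%:R - (1 + t)) ^+ 2 * heap_energy x N.
  case: (posnP N) => [->|N0]; first by rewrite big_geq// mulr0 mul0r.
  apply: (le_trans (H N _)); first by rewrite N0 leqnn.
  apply: ler_wpM2r; first exact: heap_energy_ge0.
  have : 1 <= Num.sqrt N%:R :> R by rewrite -[1 in leLHS]sqrtr1 ler_wsqrtr// ler1n.
  have : Num.sqrt N%:R ^+ 2 = N%:R :> R by rewrite sqr_sqrtr.
  move: (Num.sqrt _) => s <- s1.
  have : 0 <= (2 + t) * s - (1 + t) <= (2 + t) * s by apply/andP; split; nra.
  move=> /andP[]; move: (_ - _) => u u0 us.
  have : u ^+ 2 <= ((2 + t) * s) ^+ 2 by rewrite ler_pXn2r ?nnegrE// (le_trans u0).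
  move/le_trans; apply; rewrite exprMn ler_wpM2r ?sqr_ge0//; nra.
elim/ltn_ind: M => M IH /andP[M0 MN].
have hE : heap_energy x M <= heap_energy x N by exact: heap_energy_le.
have [M1|M1] := leqP M 1.
  have -> : M = 1%N by lia.
  have -> : (2 + t) * Num.sqrt 1%:R - (1 + t) = 1 by rewrite sqrtr1; ring.
  rewrite expr1n mul1r; apply: le_trans hE.
  have -> : M = 1%N by lia.
  by rewrite /heap_energy !big_nat1 /= x0 subr0.
have hh : (0 < M./2 <= N)%N by lia.
have s1 : 1 <= Num.sqrt M./2%:R :> R.
  by rewrite -[1 in leLHS]sqrtr1 ler_wsqrtr// ler1n; lia.
have s0 : 0 < (2 + t) * Num.sqrt M./2%:R - (1 + t) by nra.
have hlt : (M./2 < M)%N by lia.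
have := heap_minkowski x0 s0 t0 t2 hE (IH _ hlt hh).
move/le_trans; apply.
apply: ler_wpM2r; first exact: heap_energy_ge0.
have hM : t * Num.sqrt M./2%:R <= Num.sqrt M%:R.
  rewrite /t -sqrtrM// ler_wsqrtr// -natrM ler_nat; lia.
have hp : 0 <= (2 + t) * (Num.sqrt M%:R - t * Num.sqrt M./2%:R).
  by rewrite mulr_ge0 ?subr_ge0//; lra.
have u0 : 0 <= t * ((2 + t) * Num.sqrt M./2%:R - (1 + t)) + 1.
  by rewrite addr_ge0// mulr_ge0// ltW.
have le_u : t * ((2 + t) * Num.sqrt M./2%:R - (1 + t)) + 1 <=
    (2 + t) * Num.sqrt M%:R - (1 + t).
  rewrite -subr_ge0; apply: le_trans hp _; rewrite le_eqVlt; apply/orP; left.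
  by apply/eqP; ring: t2.
by rewrite ler_pXn2r// nnegrE// (le_trans u0).
Qed.

End Heap.

(** * Rayleigh quotients of symmetric matrices *)

Section RayleighQuotient.
Context {R : realType} {n : nat}.
Implicit Types (v w u : 'rV[R]_n) (M : 'M[R]_n).

Definition rdot v w : R := \sum_i v 0 i * w 0 i.

Lemma rdotC v w : rdot v w = rdot w v.
Proof. by apply: eq_bigr => i _; rewrite mulrC. Qed.

Lemma rdotDl v w u : rdot (v + w) u = rdot v u + rdot w u.
Proof. by rewrite -big_split; apply: eq_bigr => i _; rewrite mxE mulrDl. Qed.

Lemma rdotZl (a : R) v w : rdot (a *: v) w = a * rdot v w.
Proof. by rewrite mulr_sumr; apply: eq_bigr => i _; rewrite mxE mulrA. Qed.

Lemma rdotDr v w u : rdot u (v + w) = rdot u v + rdot u w.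
Proof. by rewrite rdotC rdotDl !(rdotC u). Qed.

Lemma rdotZr (a : R) v w : rdot v (a *: w) = a * rdot v w.
Proof. by rewrite rdotC rdotZl rdotC. Qed.

Lemma rdot_ge0 v : 0 <= rdot v v.
Proof. by apply: sumr_ge0 => i _; rewrite -expr2 sqr_ge0. Qed.

Lemma rdot_ge_coord v i : v 0 i ^+ 2 <= rdot v v.
Proof.
rewrite /rdot (bigD1 i)//= -expr2 lerDl.
by apply: sumr_ge0 => j _; rewrite -expr2 sqr_ge0.
Qed.

Lemma rdot_eq0 v : (rdot v v == 0) = (v == 0).
Proof.
apply/eqP/eqP => [v0|->]; last by rewrite /rdot big1// => i _; rewrite mxE mul0r.
apply/rowP => i; rewrite mxE; apply/eqP; rewrite -sqrf_eq0 eq_le sqr_ge0 andbT.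
by rewrite -v0 rdot_ge_coord.
Qed.

Lemma rdot_gt0 v : v != 0 -> 0 < rdot v v.
Proof. by move=> v0; rewrite lt_def rdot_eq0 v0 rdot_ge0. Qed.

Lemma rdotE v w : rdot v w = (v *m w^T) 0 0.
Proof. by rewrite mxE; apply: eq_bigr => i _; rewrite mxE. Qed.

Lemma rdot_mulmx M v w : rdot (v *m M) w = rdot v (w *m M^T).
Proof. by rewrite !rdotE trmx_mul trmxK mulmxA. Qed.

Lemma continuous_rdot (f g : 'rV[R]_n -> 'rV[R]_n) :
  (forall i, continuous (fun v => f v 0 i)) ->
  (forall i, continuous (fun v => g v 0 i)) ->
  continuous (fun v => rdot (f v) (g v)).
Proof.
move=> cf cg v; rewrite /rdot; apply: (@cvg_big R^o _ +%R 0 xpredT add_continuous _ (nbhs v)) => i _.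
by apply: cvgM; [exact: cf|exact: cg].
Qed.

Lemma continuous_coord_mulmx M i : continuous (fun v => (v *m M) 0 i).
Proof.
move=> v; rewrite (_ : (fun _ => _) = fun v => \sum_j v 0 j * M j i); last first.
  by apply/funext => w; rewrite mxE.
apply: (@cvg_big R^o _ +%R 0 xpredT add_continuous _ (nbhs v)) => j _.
apply: cvgM; last exact: cvg_cst.
exact: coord_continuous.
Qed.

Lemma quadratic_eq0 (c d : R) : 0 <= d ->
  (forall s, 0 <= 2 * s * c + s ^+ 2 * d) -> c = 0.
Proof.
(* The minimum would be at [- c / d]; the shifted denominator also covers [d = 0]. *)
move=> d0 /(_ (- c / (d + 1))).
have -> : 2 * (- c / (d + 1)) * c + (- c / (d + 1)) ^+ 2 * d =
  - (c ^+ 2) * ((d + 2) / (d + 1) ^+ 2).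
  by field; rewrite gt_eqF// ltr_wpDl.
rewrite mulNr oppr_ge0 pmulr_lle0 ?divr_gt0 ?exprn_gt0 ?ltr_wpDl// => c0.
by apply/eqP; rewrite -sqrf_eq0 eq_le c0 sqr_ge0.
Qed.

(** The quadratic form attains its minimum on the compact unit sphere of the orthogonal complement
    of [u], and a minimizer is an eigenvector. The vector [w0] shows that this sphere is not empty;
    [u = 0] gives the whole space. *)
Lemma rayleigh_min_compl M u w0 (lam : R) : M^T = M -> u *m M = lam *: u ->
  w0 != 0 -> rdot w0 u = 0 ->
  exists a v, [/\ v != 0, rdot v u = 0, v *m M = a *: v &
    forall w, rdot w u = 0 -> a * rdot w w <= rdot (w *m M) w].
Proof.
move=> Msym uM w00 w0u.
pose K : set 'rV[R]_n := [set v | rdot v v = 1] `&` [set v | rdot v u = 0].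
have normalize w : w != 0 -> rdot w u = 0 -> K ((Num.sqrt (rdot w w))^-1 *: w).
  move=> wn0 wu; have w1 := rdot_gt0 wn0; split => /=; last by rewrite rdotZl wu mulr0.
  rewrite rdotZl rdotZr mulrA -expr2 exprVn sqr_sqrtr ?rdot_ge0//.
  by rewrite mulVf// gt_eqF.
have idc i : continuous (fun v : 'rV[R]_n => v 0 i) by exact: coord_continuous.
have Kcl : closed K.
  apply: closedI.
    apply: (@preimage_closed _ _ (fun v => rdot v v) [set 1]); last exact: closed_eq.
    by move=> v _; exact: continuous_rdot.
  apply: (@preimage_closed _ _ (fun v => rdot v u) [set 0]); last exact: closed_eq.
  by move=> v _; apply: continuous_rdot => // i; exact: cst_continuous.
have Kco : compact K.
  have := @rV_compact _ n (fun=> `[(-1 : R), 1]%classic) (fun=> @segment_compact _ _ _).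
  move=> boxco; apply: (subclosed_compact Kcl boxco) => v [/= v1 _] i.
  have := rdot_ge_coord v i; rewrite v1 /= in_itv/= => v_le1.
  by apply/andP; split; nra.
have K0 : K !=set0 by eexists; exact: normalize w00 w0u.
have cq : continuous (fun v => rdot (v *m M) v).
  by apply: continuous_rdot => // i; exact: continuous_coord_mulmx.
have [v] := @compact_EVT_min _ _ _ K K0 Kco (continuous_subspaceT cq).
rewrite inE => -[/= v1 vu] vmin.
pose a := rdot (v *m M) v.
have amin w : rdot w u = 0 -> a * rdot w w <= rdot (w *m M) w.
  move=> wu; have [->|wn0] := eqVneq w 0.
    by rewrite -(scale0r 0) -scalemxAl !rdotZl !mul0r mulr0.
  have := vmin _ (mem_set (normalize w wn0 wu)).
  rewrite -/a -scalemxAl !rdotZl !rdotZr mulrA -expr2 exprVn sqr_sqrtr ?rdot_ge0//.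
  by rewrite ler_pdivlMl ?rdot_gt0// mulrC.
have v0 : v != 0 by rewrite -rdot_eq0 v1 oner_eq0.
exists a, v; split => //.
(* The residual stays orthogonal to [u], so [v] may be varied along it; the first variation at the
   minimum is [rdot z z], which must vanish. *)
pose z := v *m M - a *: v.
have zu : rdot z u = 0.
  by rewrite /z -scaleNr rdotDl rdotZl vu rdot_mulmx Msym uM rdotZr vu !mulr0 addr0.
suff z0 : rdot z z = 0 by apply/subr0_eq/eqP; rewrite -rdot_eq0 -/z z0.
have -> : rdot z z = rdot (v *m M) z - a * rdot v z.
  by rewrite -mulNr -rdotZl -rdotDl scaleNr.
clearbody z.
apply: (@quadratic_eq0 _ (rdot (z *m M) z - a * rdot z z)).
  by rewrite subr_ge0; exact: amin.
move=> s; have := amin (v + s *: z).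
rewrite rdotDl rdotZl vu zu mulr0 addr0 => /(_ erefl).
have zv : rdot (z *m M) v = rdot (v *m M) z by rewrite rdot_mulmx Msym rdotC.
rewrite mulmxDl -scalemxAl !(rdotDl, rdotDr, rdotZl, rdotZr) zv (rdotC z v) v1 -/a.
move: (rdot (v *m M) z) (rdot v z) (rdot (z *m M) z) (rdot z z) => *; nra.
Qed.

End RayleighQuotient.

(** * The quadratic form of the graph Laplacian *)

Section Laplacian.
Context {R : realType} {n : nat} (G : graph n).
Implicit Types v : 'rV[R]_n.

Lemma laplacian_sym : (laplacian R G)^T = laplacian R G.
Proof.
by rewrite /laplacian linearB /= tr_diag_mx; congr (_ - _);
  apply/matrixP => i j; rewrite !mxE adj_sym.
Qed.

Lemma laplacian_const :
  (const_mx 1 : 'rV_n) *m laplacian R G = 0 *: const_mx 1.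
Proof.
rewrite scale0r; apply/rowP => j; rewrite !mxE.
under eq_bigr do rewrite !mxE mul1r.
rewrite sumrB (bigD1 j)//= eqxx mulr1n big1 => [|i /negbTE ->]; last by rewrite mulr0n.
rewrite addr0 -sum1_card natr_sum big_mkcond/= -sumrB big1// => i _.
by rewrite adj_sym -topredE/=; case: (G j i); rewrite /= ?subrr.
Qed.

Lemma laplacian_form v : rdot (v *m laplacian R G) v =
  2^-1 * \sum_i \sum_j (G i j)%:R * (v 0 i - v 0 j) ^+ 2.
Proof.
pose A : R := \sum_i \sum_j (G i j)%:R * v 0 i ^+ 2.
pose B : R := \sum_i \sum_j (G i j)%:R * (v 0 i * v 0 j).
have -> : \sum_i \sum_j (G i j)%:R * (v 0 i - v 0 j) ^+ 2 = A - 2 * B + A.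
  rewrite {2}/A [X in _ = _ + X]exchange_big /A /B mulr_sumr -sumrB -big_split/=.
  apply: eq_bigr => i _; rewrite mulr_sumr -sumrB -big_split/=.
  by apply: eq_bigr => j _; rewrite (adj_sym G j i); ring.
have -> : rdot (v *m laplacian R G) v = A - B; last by field.
rewrite /rdot /A -sumrB; apply: eq_bigr => j _; rewrite !mxE.
under eq_bigr do rewrite !mxE mulrBr.
rewrite sumrB (bigD1 j)//= eqxx mulr1n big1 => [|i /negbTE ->]; last by rewrite mulr0n mulr0.
rewrite addr0 -sum1_card natr_sum big_mkcond/= mulrBl; congr (_ - _).
  rewrite mulr_sumr mulr_suml; apply: eq_bigr => i _.
  by rewrite -topredE/=; case: (G j i) => /=; ring.
rewrite mulr_suml; apply: eq_bigr => i _.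
by rewrite (adj_sym G j i); ring.
Qed.

End Laplacian.

(** * Graphs given by a parent function *)

Section ParentGraph.
Context {n : nat} (p : 'I_n -> 'I_n).

(** A root is encoded as its own parent; the condition [i != j] discards the resulting loop. *)
Definition parent_adj : rel 'I_n :=
  fun i j => (i != j) && ((p i == j) || (p j == i)).

Lemma parent_adj_sym : symmetric parent_adj.
Proof. by move=> i j; rewrite /parent_adj eq_sym orbC. Qed.

Lemma parent_adj_irr : irreflexive parent_adj.
Proof. by move=> i; rewrite /parent_adj eqxx. Qed.

Definition parent_graph : graph n := Graph parent_adj_sym parent_adj_irr.

(** Iterating [p] lowers the rank [h] until the root [r] is reached. *)
Lemma parent_graph_connected (r : 'I_n) (h : 'I_n -> nat) :
  (forall i, i != r -> (h (p i) < h i)%N) -> graph_connected parent_graph.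
Proof.
move=> hp.
have to_root i : connect parent_graph i r.
  elim/ltn_ind: {i}(h i) {-2}i (erefl (h i)) => k IH i hi.
  have [->|ir] := eqVneq i r; first exact: connect0.
  have pi := hp _ ir; apply: (@connect_trans _ _ (p i)).
    apply: connect1; rewrite /= /parent_adj eqxx orTb andbT.
    by apply: contraTneq pi => <-; rewrite ltnn.
  by apply: IH (erefl _); rewrite -hi.
move=> i j; apply: connect_trans (to_root i) _.
by rewrite (sym_connect_sym parent_adj_sym).
Qed.

Context {R : realType}.
Implicit Type v : 'rV[R]_n.

Definition parent_energy v : R := \sum_i (v 0 i - v 0 (p i)) ^+ 2.

Lemma laplacian_le_energy v :
  rdot (v *m laplacian R parent_graph) v <= parent_energy v.
Proof.
rewrite laplacian_form ler_pdivrMl//.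
apply: (@le_trans _ _ (\sum_i \sum_j (((p i == j)%:R + (p j == i)%:R) *
    (v 0 i - v 0 j) ^+ 2))).
  apply: ler_sum => i _; apply: ler_sum => j _.
  apply: ler_wpM2r; first exact: sqr_ge0.
  rewrite /= /parent_adj -natrD ler_nat.
  by case: (i != j); case: (p i == j); case: (p j == i).
have -> : \sum_i \sum_j (((p i == j)%:R + (p j == i)%:R) * (v 0 i - v 0 j) ^+ 2)
  = \sum_i \sum_j ((p i == j)%:R * (v 0 i - v 0 j) ^+ 2) +
    \sum_i \sum_j ((p i == j)%:R * (v 0 i - v 0 j) ^+ 2).
  rewrite [X in _ = _ + X]exchange_big -big_split/=; apply: eq_bigr => i _.
  rewrite -big_split/=; apply: eq_bigr => j _; ring.
have -> : \sum_i \sum_j ((p i == j)%:R * (v 0 i - v 0 j) ^+ 2) = parent_energy v.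
  apply: eq_bigr => i _; rewrite (bigD1 (p i))//= eqxx mul1r big1 ?addr0// => j.
  by rewrite eq_sym => /negbTE ->; rewrite mul0r.
by rewrite le_eqVlt; apply/orP; left; apply/eqP; ring.
Qed.

(** The factor 2 accounts for two vertices that are each other's parent: the energy counts their
    edge twice. *)
Lemma energy_le_laplacian v :
  parent_energy v <= 2 * rdot (v *m laplacian R parent_graph) v.
Proof.
rewrite laplacian_form mulrA divff// mul1r; apply: ler_sum => i _.
have pos j : 0 <= (parent_graph i j)%:R * (v 0 i - v 0 j) ^+ 2.
  by rewrite mulr_ge0 ?sqr_ge0.
rewrite (bigD1 (p i))//=.
have [e|pi] := eqVneq i (p i).
  rewrite -e subrr expr0n/= mulr0 add0r.
  by apply: sumr_ge0 => j _; exact: pos.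
rewrite {1}/parent_adj pi eqxx mul1r lerDl.
by apply: sumr_ge0 => j _; exact: pos.
Qed.

End ParentGraph.

(** Oriented towards the parent, a lost edge is [[set i; p i]] for some vertex [i] whose parent
    changed. *)
Lemma card_parent_edges_sub n (p p' : 'I_n -> 'I_n) :
  (#|edges (parent_graph p) :\: edges (parent_graph p')| <=
    #|[set i | p i != p' i]%SET|)%N.
Proof.
apply: leq_trans (leq_imset_card (fun i => [set i; p i]%SET) _).
apply: subset_leq_card; apply/fintype.subsetP => e /finset.setDP[/imsetP[[i j] ij ->] e'].
wlog pij : i j ij e' / p i == j.
  move=> W; move: (ij); rewrite finset.inE /= /parent_adj => /andP[_ /orP[|pji]].
    exact: W.
  rewrite [[set i; j]%SET]finset.setUC; apply: W => //.
    by move: ij; rewrite !finset.inE /= parent_adj_sym.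
  by rewrite [[set _; _]%SET]finset.setUC.
apply/imsetP; exists i; last by rewrite /= (eqP pij).
rewrite finset.inE; apply: contra e' => /eqP pi; apply/imsetP; exists (i, j) => //.
move: ij; rewrite !finset.inE /= /parent_adj => /andP[-> _].
by rewrite -pi pij.
Qed.

Lemma card_parent_edges_changed n (p p' : 'I_n -> 'I_n) :
  (#|(edges (parent_graph p) :\: edges (parent_graph p')) :|:
     (edges (parent_graph p') :\: edges (parent_graph p))|%SET <= 2 * #|[set i | p i != p' i]%SET|)%N.
Proof.
apply: leq_trans (leq_card_setU _ _) _.
rewrite mul2n -addnn; apply: leq_add; first exact: card_parent_edges_sub.
rewrite (_ : [set i | p i != p' i]%SET = [set i | p' i != p i]%SET).
  exact: card_parent_edges_sub.
by apply/finset.setP => i; rewrite !finset.inE eq_sym.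
Qed.

(** * Two binary heaps joined by a bridge vertex *)

(* Vertices 0, ..., N.  The bridge t is the parent of the roots 0 and N of a
   heap on {0, ..., t-1} and of a mirrored heap on {t+1, ..., N}; left_node t j
   and right_node N t j are the j-th nodes of the two heaps in the 1-based
   numbering in which the parent of j is j./2, with the bridge as node 0. *)
Definition left_node (t j : nat) : nat := if j is k.+1 then k else t.
Definition right_node (N t j : nat) : nat := if j is k.+1 then (N - k)%N else t.

Definition bridge_parent (N t i : nat) : nat :=
  if (i < t)%N then left_node t (i.+1)./2
  else if (t < i)%N then right_node N t (N.+1 - i)./2 else t.

Definition bridge_parent_ord (N t : nat) (i : 'I_N.+1) : 'I_N.+1 :=
  inord (bridge_parent N t i).
Arguments bridge_parent_ord : clear implicits.

Definition bridged_heaps (N t : nat) : graph N.+1 :=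
  parent_graph (bridge_parent_ord N t).

Section BridgedHeaps.
Context {N t : nat} (t_gt0 : (0 < t)%N) (t_ltN : (t < N)%N).

(** Parents lie farther from the bridge, up to the root 0 or [N], whose parent is the bridge.
    Connectivity and the cut property both follow from this case analysis. *)
Lemma bridge_parentP i : (i <= N)%N ->
  [\/ [\/ i = 0, i = t | i = N] /\ bridge_parent N t i = t,
      (i < t)%N /\ (bridge_parent N t i < i)%N |
      (t < i)%N /\ (i < bridge_parent N t i <= N)%N].
Proof.
move=> iN; rewrite /bridge_parent /left_node /right_node.
case: ltngtP => it.
- case: i it iN => [|i] it iN; first by apply: Or31; split => //; apply: Or31.
  by apply: Or32; split => //; case E: (_./2) => [|k]; lia.
- have [->|iN'] := eqVneq i N.
    by apply: Or31; rewrite subSnn; split => //; apply: Or33.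
  by apply: Or33; split => //; case E: (_./2) => [|k]; lia.
- by apply: Or31; split => //; apply: Or32.
Qed.

Lemma val_bridge_parent_ord (i : 'I_N.+1) :
  bridge_parent_ord N t i = bridge_parent N t i :> nat.
Proof.
rewrite /bridge_parent_ord inordK// ltnS.
by have := ltn_ord i; rewrite ltnS => /bridge_parentP; case=> -[]; lia.
Qed.

Lemma bridged_heaps_connected : graph_connected (bridged_heaps N t).
Proof.
apply: (@parent_graph_connected _ _ (inord t)
  (fun i => if (i < t)%N then i.+1 else if (t < i)%N then N.+1 - i else 0)%N).
move=> i; rewrite -val_eqE /= inordK; last by rewrite ltnS ltnW.
move=> it.
rewrite val_bridge_parent_ord.
have := ltn_ord i; rewrite ltnS => /bridge_parentP.
by case=> -[]; [case|idtac|idtac]; intros; do !case: ifP => ?; lia.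
Qed.

(** The bridge is a cut vertex: news can leave a side only through it. *)
Lemma bridged_heaps_cut (i j : 'I_N.+1) : bridged_heaps N t i j ->
  ((j < t)%N -> (i <= t)%N) /\ ((t < j)%N -> (t <= i)%N).
Proof.
rewrite /= /parent_adj -!val_eqE /= !val_bridge_parent_ord => /andP[_].
have := ltn_ord i; rewrite ltnS => /bridge_parentP;
have := ltn_ord j; rewrite ltnS => /bridge_parentP.
by case=> -[? ?]; case=> -[? ?]; lia.
Qed.

Context {R : realType}.
Implicit Type v : 'rV[R]_N.+1.

Lemma sum_bridge (F : nat -> R) : \sum_(i < N.+1) F i =
  F t + \sum_(1 <= j < t.+1) F (left_node t j) +
  \sum_(1 <= j < (N - t).+1) F (right_node N t j).
Proof.
have tN : (t < N.+1)%N by rewrite ltnS ltnW.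
rewrite -(big_mkord xpredT F) (@big_cat_nat _ _ _ t)//=; last exact: ltnW.
rewrite (@big_ltn _ _ _ t)//=.
rewrite addrA [X in X + _]addrC; congr (_ + _ + _).
  by rewrite big_add1.
rewrite -[t.+1]add0n big_addn subSS big_nat_rev [RHS]big_add1 /=.
by apply: eq_big_nat => j /andP[_ j_lt] /=; congr F; lia.
Qed.

(** Subtracting [V t] makes node 0 of both heaps vanish, as Hardy's inequality requires. *)
Lemma bridge_energyE v (V := fun i => v 0 (inord i)) :
  parent_energy (bridge_parent_ord N t) v =
  heap_energy (fun j => V (left_node t j) - V t) t +
  heap_energy (fun j => V (right_node N t j) - V t) (N - t).
Proof.
have -> : parent_energy (bridge_parent_ord N t) v =
    \sum_(i < N.+1) (V i - V (bridge_parent N t i)) ^+ 2.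
  by apply: eq_bigr => i _; rewrite /V inord_val.
rewrite (sum_bridge (fun i => (V i - V (bridge_parent N t i)) ^+ 2)).
rewrite {1}/bridge_parent ltnn subrr expr0n add0r.
congr (_ + _); apply: eq_big_nat => -[//|j] /andP[_ jt].
  rewrite opprB addrA subrK; congr ((_ - V _) ^+ 2).
  by rewrite /bridge_parent /= ifT.
rewrite opprB addrA subrK; congr ((_ - V _) ^+ 2).
rewrite /bridge_parent /= ifF; last by lia.
rewrite ifT; last lia.
by have -> : (N.+1 - (N - j) = j.+1)%N by lia.
Qed.

Lemma bridge_sum_sqr v (V := fun i => v 0 (inord i)) :
  rdot v v = V t ^+ 2 + \sum_(1 <= j < t.+1) V (left_node t j) ^+ 2 +
  \sum_(1 <= j < (N - t).+1) V (right_node N t j) ^+ 2.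
Proof.
rewrite -(sum_bridge (fun i => V i ^+ 2)); apply: eq_bigr => i _.
by rewrite /V inord_val expr2.
Qed.

Lemma bridge_poincare v : rdot v (const_mx 1) = 0 ->
  rdot v v <= 12 * N.+1%:R * parent_energy (bridge_parent_ord N t) v.
Proof.
(* The sum of the squares is smallest when centered at the mean, here 0. *)
move=> v1; pose c := v 0 (inord t); pose w := v - c *: const_mx 1.
have vw : rdot v v <= rdot w w.
  rewrite /w -scaleNr !(rdotDl, rdotDr, rdotZl, rdotZr) (rdotC _ v) v1.
  rewrite !mulr0 add0r addr0 lerDl mulrA -expr2 mulr_ge0 ?sqr_ge0//.
  exact: rdot_ge0.
apply: (le_trans vw); rewrite bridge_sum_sqr bridge_energyE.
have wE i : w 0 (inord i) = v 0 (inord i) - v 0 (inord t).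
  by rewrite !mxE mulr1.
rewrite wE subrr expr0n add0r.
under eq_bigr do rewrite wE.
under [X in _ + X <= _]eq_bigr do rewrite wE.
set x := (fun j => v 0 (inord (left_node t j)) - v 0 (inord t)).
set y := (fun j => v 0 (inord (right_node N t j)) - v 0 (inord t)).
have widen M (z : nat -> R) : (M <= N.+1)%N -> z 0 = 0 ->
    \sum_(1 <= j < M.+1) z j ^+ 2 <= 12 * N.+1%:R * heap_energy z M.
  move=> MN z0; apply: le_trans (heap_hardy _ z0) _.
  by rewrite ler_wpM2r ?heap_energy_ge0// ler_pM2l// ler_nat.
rewrite mulrDr; apply: lerD; apply: widen; rewrite ?subrr//; lia.
Qed.

(** This is the effect of bounded degrees: [(a - b) ^+ 2] is at most [2 * a ^+ 2 + 2 * b ^+ 2], and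
    a node has at most two children in its heap. The constant 10 is not sharp. *)
Lemma bridge_energy_le v :
  parent_energy (bridge_parent_ord N t) v <= 10 * rdot v v.
Proof.
rewrite bridge_energyE bridge_sum_sqr.
pose V := fun i => v 0 (inord i).
have half (f : nat -> nat) M : f 0%N = t ->
    heap_energy (fun j => V (f j) - V t) M <=
    2 * V t ^+ 2 + 6 * \sum_(1 <= j < M.+1) V (f j) ^+ 2.
  move=> f0.
  have step : heap_energy (fun j => V (f j) - V t) M <=
    2 * \sum_(1 <= j < M.+1) V (f j) ^+ 2 +
    2 * \sum_(1 <= j < M.+1) V (f j./2) ^+ 2.
    rewrite !mulr_sumr -big_split/=; apply: ler_sum => j _.
    rewrite -subr_ge0; apply: le_trans (sqr_ge0 (V (f j) + V (f j./2))) _.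
    by rewrite le_eqVlt; apply/orP; left; apply/eqP; ring.
  have := sum_half M (fun j => sqr_ge0 (V (f j))); rewrite f0 => h.
  have M2 : \sum_(1 <= j < M./2.+1) V (f j) ^+ 2 <=
      \sum_(1 <= j < M.+1) V (f j) ^+ 2.
    have := @ler_sum_prefix R (fun j => V (f j.+1) ^+ 2) M./2 M.
    by rewrite !big_add1 /=; apply => [|j]; [lia|exact: sqr_ge0].
  lra.
have hl := half (left_node t) t erefl.
have hr := half (right_node N t) (N - t)%N erefl.
have pos (f : nat -> nat) M : 0 <= \sum_(1 <= j < M.+1) V (f j) ^+ 2.
  by apply: sumr_ge0 => j _; exact: sqr_ge0.
have := pos (left_node t) t; have := pos (right_node N t) (N - t)%N.
have := sqr_ge0 (V t); move: hl hr; rewrite /V; lra.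
Qed.

End BridgedHeaps.

(** * Laplacian spectrum and condition number of the bridged heaps *)

Section BridgedHeapsSpectrum.
Context {R : realType} {N t : nat} (t_gt0 : (0 < t)%N) (t_ltN : (t < N)%N).
Let L := laplacian R (bridged_heaps N t).
Implicit Types (a : R) (v : 'rV[R]_N.+1).

Lemma eigenvalue_bridged_le a : eigenvalue L a -> a <= 10.
Proof.
move=> /eigenvalueP[v vL v0]; rewrite -(@ler_pM2r _ (rdot v v)) ?rdot_gt0//.
rewrite -rdotZl -vL; apply: le_trans (laplacian_le_energy _ _) _.
exact: bridge_energy_le.
Qed.

Lemma bridge_poincare_laplacian v : rdot v (const_mx 1) = 0 ->
  rdot v v <= 24 * N.+1%:R * rdot (v *m L) v.
Proof.
move=> v1; apply: le_trans (bridge_poincare t_gt0 t_ltN v1) _.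
have -> : 24 * N.+1%:R * rdot (v *m L) v =
  12 * N.+1%:R * (2 * rdot (v *m L) v) by ring.
by rewrite ler_pM2l ?mulr_gt0// energy_le_laplacian.
Qed.

Lemma eigenvalue_bridged_ge a : eigenvalue L a -> a != 0 ->
  (24 * N.+1%:R)^-1 <= a.
Proof.
move=> /eigenvalueP[v vL v0] a0.
(* Eigenvectors of a symmetric matrix for distinct eigenvalues, here [a] and 0, are orthogonal. *)
have v1 : rdot v (const_mx 1) = 0.
  apply: (mulfI a0); rewrite mulr0 -rdotZl -vL rdot_mulmx laplacian_sym.
  by rewrite laplacian_const rdotZr mul0r.
have := bridge_poincare_laplacian v1; rewrite vL rdotZl mulrA.
rewrite -[leLHS]mul1r ler_pM2r ?rdot_gt0// => h.
by rewrite -[leLHS]mulr1 ler_pdivrMl ?mulr_gt0.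
Qed.

Lemma eigenvalue_bridged0 : eigenvalue L 0.
Proof.
apply/eigenvalueP; exists (const_mx 1); first exact: laplacian_const.
by apply/eqP => /rowP/(_ 0); rewrite !mxE => /eqP; rewrite oner_eq0.
Qed.

Lemma graph_chi_bridged_le : graph_chi R (bridged_heaps N t) <= 240 * N.+1%:R.
Proof.
rewrite /graph_chi -/L.
set E := [set a | eigenvalue L a]; set E' := [set a | _ /\ _].
have supE : sup E <= 10.
  by apply: ge_sup; [exists 0; exact: eigenvalue_bridged0|exact: eigenvalue_bridged_le].
(* Without nonzero eigenvalues, [inf] takes its default value 0 and so does the quotient. *)
have [->|/set0P E'0] := eqVneq E' set0.
  by rewrite inf0 invr0 mulr0 mulr_ge0.
have infE : (24 * N.+1%:R)^-1 <= inf E'.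
  by apply: lb_le_inf => // a [aE a0]; exact: eigenvalue_bridged_ge.
have inf_gt0 : 0 < inf E' by apply: lt_le_trans infE; rewrite invr_gt0 mulr_gt0.
rewrite ler_pdivrMr//; apply: (le_trans supE).
have -> : 240 * N.+1%:R * inf E' = 10 * (24 * N.+1%:R * inf E') by ring.
rewrite -[leLHS]mulr1 ler_pM2l// -ler_pdivrMl ?mulr_gt0// mulr1//.
Qed.

(** The largest eigenvalue is minus the minimum of the Rayleigh quotient of [- L], with the void
    constraint [u = 0]. The test vector is the indicator of vertex 0, whose edge to the bridge gives
    energy at least 1. *)
Lemma exists_large_eigenvalue : exists2 a, eigenvalue L a & 2^-1 <= a.
Proof.
pose e : 'rV[R]_N.+1 := delta_mx 0 0.
have e0 : e != 0.
  by apply/eqP => /rowP/(_ 0); rewrite !mxE !eqxx => /eqP; rewrite oner_eq0.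
have [||||a [v [v0 _ vL amin]]] := @rayleigh_min_compl R N.+1 (- L) 0 e 0.
- by rewrite linearN /= laplacian_sym.
- by rewrite mul0mx scaler0.
- exact: e0.
- by rewrite rdotC -(scale0r 0) rdotZl mul0r.
exists (- a).
  apply/eigenvalueP; exists v => //.
  by rewrite scaleNr -vL mulmxN opprK.
have ee : rdot e e = 1.
  rewrite /rdot (bigD1 0)//= !mxE eqxx mulr1 big1 ?addr0// => i /negbTE i0.
  by rewrite !mxE i0 mulr0n mul0r.
have := amin e; rewrite rdotC -(scale0r 0) rdotZl mul0r => /(_ erefl).
rewrite ee mulr1 mulmxN -scaleN1r rdotZl mulN1r => a_le.
have := energy_le_laplacian (bridge_parent_ord N t) e.
suff : 1 <= parent_energy (bridge_parent_ord N t) e.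
  by move: a_le; rewrite /L /bridged_heaps; lra.
rewrite /parent_energy (bigD1 0)//= !mxE !eqxx/=.
have /negbTE -> : bridge_parent_ord N t 0 != 0.
  rewrite -val_eqE /= val_bridge_parent_ord//.
  by rewrite /bridge_parent t_gt0 /= -lt0n.
rewrite subr0 expr1n lerDl; apply: sumr_ge0 => i _; exact: sqr_ge0.
Qed.

Hypothesis t_mid : N = t.*2.

(* Test vector for the Fiedler value: 1 on the left heap, -1 on the right. *)
Lemma exists_small_eigenvalue :
  exists2 a, eigenvalue L a /\ a != 0 & a <= t%:R^-1.
Proof.
pose W (i : nat) : R := (i < t)%N%:R - (t < i)%N%:R.
pose w : 'rV[R]_N.+1 := \row_i W i.
have W0 : W t = 0 by rewrite /W ltnn subrr.
have W_lt k : (k < t)%N -> W k = 1.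
  by move=> kt; rewrite /W kt ltnNge ltnW// subr0.
have W_gt k : (t < k)%N -> W k = -1.
  by move=> tk; rewrite /W tk ltnNge ltnW// sub0r.
have Wl j : (1 <= j < t.+1)%N -> W (left_node t j) = 1.
  by case: j => [|j]//=; exact: W_lt.
have Wr j : (1 <= j < (N - t).+1)%N -> W (right_node N t j) = -1.
  by case: j => [|j]//= jt; apply: W_gt; lia.
have Nt : (N - t)%N = t by lia.
have w1 : rdot w (const_mx 1) = 0.
  rewrite /rdot; under eq_bigr do rewrite !mxE mulr1.
  rewrite (sum_bridge t_gt0 t_ltN W) W0 add0r.
  rewrite (eq_big_nat _ _ Wl) (eq_big_nat _ _ Wr) !sumr_const_nat.
  by rewrite Nt !subSS subn0 mulNrn subrr.
have ww : rdot w w = 2 * t%:R.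
  rewrite /rdot; under eq_bigr do rewrite !mxE -expr2.
  rewrite (sum_bridge t_gt0 t_ltN (fun i => W i ^+ 2)) W0 expr0n add0r.
  have Wl2 j : (1 <= j < t.+1)%N -> W (left_node t j) ^+ 2 = 1.
    by move=> /Wl ->; rewrite expr1n.
  have Wr2 j : (1 <= j < (N - t).+1)%N -> W (right_node N t j) ^+ 2 = 1.
    by move=> /Wr ->; rewrite sqrrN expr1n.
  rewrite (eq_big_nat _ _ Wl2) (eq_big_nat _ _ Wr2).
  by rewrite !sumr_const_nat Nt subSS subn0; ring.
(* The test vector varies only along the two edges from the bridge to the roots 0 and [N]. *)
have energy : parent_energy (bridge_parent_ord N t) w <= 2.
  apply: (@le_trans _ _ (\sum_(i < N.+1) ((i == 0)%:R + (i == ord_max)%:R))).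
    apply: ler_sum => i _; rewrite !mxE val_bridge_parent_ord// -!val_eqE /=.
    have := ltn_ord i; rewrite ltnS => /(bridge_parentP t_gt0 t_ltN).
    move: (nat_of_ord i) (bridge_parent N t i) => j b.
    have pos : 0 <= (j == 0)%:R + (j == N)%:R :> R by rewrite addr_ge0.
    case=> -[].
    - case=> [-> ->|-> ->|-> ->]; rewrite W0 subr0.
      + by rewrite W_lt// expr1n eqxx lerDl.
      + by rewrite expr0n addr_ge0.
      + by rewrite W_gt// sqrrN expr1n eqxx lerDr.
    - by move=> jt bj; rewrite (W_lt j jt) (W_lt b (ltn_trans bj jt)) subrr expr0n.
    - by move=> tj /andP[jb _]; rewrite (W_gt j tj) (W_gt b (ltn_trans tj jb)) subrr expr0n.
  rewrite big_split/= (bigD1 0)//= big1 => [|i /negbTE ->//].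
  by rewrite (bigD1 ord_max)//= big1 => [|i /negbTE ->//]; rewrite !eqxx /=; lra.
have w0 : w != 0.
  by rewrite -rdot_eq0 ww mulf_neq0// pnatr_eq0 -lt0n.
have [||||a [v [v0 v1 vL amin]]] :=
  @rayleigh_min_compl R N.+1 L (const_mx 1) w 0.
- exact: laplacian_sym.
- exact: laplacian_const.
- exact: w0.
- exact: w1.
exists a; first split.
- by apply/eigenvalueP; exists v.
- apply: contra_neq v0 => a0; apply/eqP; rewrite -rdot_eq0 eq_le rdot_ge0 andbT.
  by have := bridge_poincare_laplacian v1; rewrite vL a0 rdotZl mul0r mulr0.
- have := amin w w1; rewrite ww => h.
  have := laplacian_le_energy (bridge_parent_ord N t) w => h'.
  have t0 : 0 < t%:R :> R by rewrite ltr0n.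
  rewrite -[leRHS]mul1r ler_pdivlMr//.
  by move: h; rewrite /L /bridged_heaps; lra.
Qed.

Lemma graph_chi_bridged_ge : t%:R / 2 <= graph_chi R (bridged_heaps N t).
Proof.
rewrite /graph_chi -/L.
set E := [set a | eigenvalue L a]; set E' := [set a | _ /\ _].
have [a aE a_ge] := exists_large_eigenvalue.
have [b bE' b_le] := exists_small_eigenvalue.
have supE : 2^-1 <= sup E.
  by apply: (le_trans a_ge); apply: ub_le_sup => //; exists 10; exact: eigenvalue_bridged_le.
have infb : inf E' <= b.
  apply: ge_inf => //; exists (24 * N.+1%:R)^-1 => c [cE c0].
  exact: eigenvalue_bridged_ge.
have infE : (24 * N.+1%:R)^-1 <= inf E'.
  by apply: lb_le_inf => [|c [cE c0]]; [exists b|exact: eigenvalue_bridged_ge].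
have inf_gt0 : 0 < inf E' by apply: lt_le_trans infE; rewrite invr_gt0 mulr_gt0.
rewrite ler_pdivlMr// mulrAC; apply: le_trans supE.
have t0 : 0 < t%:R :> R by rewrite ltr0n.
have -> : t%:R * inf E' / 2 = 2^-1 * (t%:R * inf E') by ring.
rewrite -[leRHS]mulr1 ler_pM2l//.
by rewrite -ler_pdivlMl// mulr1 (le_trans infb).
Qed.

End BridgedHeapsSpectrum.

(** * The chain of coordinates in l2 *)

(** Swaps [k] and [k.+1] whenever [odd k = b]. For [b = true] the index 0 has no partner and is
    fixed, since [0.-1 = 0]. *)
Definition flip_index (b : bool) (k : nat) : nat :=
  if odd k == b then k.+1 else k.-1.

Lemma flip_indexK b : involutive (flip_index b).
Proof.
move=> k; rewrite /flip_index; case: (eqVneq (odd k) b) => [kb|kb].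
  by rewrite oddS kb; case: b kb.
case: k kb => [|k] /=; first by case: b.
by case: (odd k); case: b.
Qed.

Section FlippedSums.
Context {R : realType}.
Implicit Type a : nat -> R.

(** A prefix whose length has parity [b] cuts no pair, so the swap permutes it. *)
Lemma sum_flip_index b a n : odd n = b ->
  \sum_(0 <= k < n) a (flip_index b k) = \sum_(0 <= k < n) a k.
Proof.
elim/ltn_ind: n => -[|[|n]] IH nb.
- by rewrite !big_geq.
- by rewrite !big_nat1 /flip_index -nb.
- rewrite !big_nat_recr//= IH//; last by rewrite -nb /= negbK.
  rewrite /flip_index -nb /= negbK eqxx.
  by case: (odd n) => /=; rewrite -!addrA; congr (_ + _); rewrite addrC.
Qed.

Lemma sum_flip_index_le b a n : (forall k, 0 <= a k) ->
  \sum_(0 <= k < n) a (flip_index b k) <= \sum_(0 <= k < n.+1) a k.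
Proof.
move=> a0; have [nb|nb] := eqVneq (odd n) b.
  by rewrite (sum_flip_index a nb) ler_sum_prefix.
rewrite -(@sum_flip_index b a); first by apply: ler_sum_prefix => // k.
by move: nb => /=; case: (odd n); case: b.
Qed.

End FlippedSums.

Section Flip.
Context {R : realType}.
Implicit Types x y v : ell2 R.

Lemma series_sqr_le x n : series (fun k => x k ^+ 2) n <= dot x x.
Proof.
have -> : (fun k => x k ^+ 2) = (fun k => x k * x k) by apply/funext => k.
apply: nondecreasing_cvgn_le; last exact: is_cvg_dot.
by apply/nondecreasing_seqP => k; rewrite /series/= big_nat_recr//= lerDl
  -expr2 sqr_ge0.
Qed.

Lemma series_flip_le b x n :
  series (fun k => x (flip_index b k) ^+ 2) n <= dot x x.
Proof.
apply: le_trans (series_sqr_le x n.+1).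
by apply: (sum_flip_index_le b (a := fun k => x k ^+ 2)) => k; exact: sqr_ge0.
Qed.

Lemma flip_square_summable b x :
  (fun k => x (flip_index b k)) \in @square_summable R.
Proof.
apply/square_summableP; apply: nondecreasing_is_cvgn.
  by apply/nondecreasing_seqP => k; rewrite /series/= big_nat_recr//= lerDl sqr_ge0.
by exists (dot x x) => _ [n _ <-]; exact: series_flip_le.
Qed.

Definition flip b x : ell2 R := Ell2 (flip_square_summable b x).

Lemma flipK b : involutive (flip b).
Proof. by move=> x; apply/val_inj/funext => k /=; rewrite flip_indexK. Qed.

Lemma flipD b x y : flip b (x + y) = flip b x + flip b y.
Proof. exact/val_inj. Qed.

Lemma dot_flip_le b x : dot (flip b x) (flip b x) <= dot x x.
Proof.
rewrite {1}/dot; apply: limr_le; first exact: is_cvg_dot.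
by near=> n; exact: series_flip_le.
Unshelve. all: by end_near. Qed.

Lemma dot_flip b x : dot (flip b x) (flip b x) = dot x x.
Proof.
apply/eqP; rewrite eq_le dot_flip_le/=.
by rewrite -{1 2}(flipK b x) dot_flip_le.
Qed.

(** Polarization: the isometry [flip b] is applied to [x + flip b y]. *)
Lemma dot_flipC b x y : dot (flip b x) y = dot x (flip b y).
Proof.
have := dot_flip b (x + flip b y); rewrite flipD flipK.
rewrite !(dotDl, dotDr) !dot_flip (dotC y) (dotC (flip b y) x); lra.
Qed.

Lemma ell2_norm_sqr x : `|x| ^+ 2 = dot x x.
Proof. by rewrite /Num.norm /= /ell2_norm sqr_sqrtr// dot_ge0. Qed.

Lemma norm_flip b x : `|flip b x| = `|x|.
Proof. by rewrite /Num.norm /= /ell2_norm dot_flip. Qed.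

Lemma dot_flip_bound b x : `|dot (flip b x) x| <= dot x x.
Proof.
have := dot_ge0 (flip b x + x); have := dot_ge0 (flip b x + (-1) *: x).
rewrite !(dotDl, dotDr, dotZl, dotZr) dot_flip (dotC x) => h1 h2.
by rewrite ler_norml; apply/andP; split; lra.
Qed.

End Flip.

(** * Fréchet gradients on l2 *)

Section Gradients.
Context {R : realType}.
Implicit Types (x y v g w : ell2 R) (h : ell2 R -> R^o).

Lemma dot_is_linear g : linear (dot g : ell2 R -> R^o).
Proof. by move=> a x y; rewrite dotDr dotZr. Qed.

HB.instance Definition _ g :=
  GRing.isLinear.Build R (ell2 R) R^o _ (dot g) (dot_is_linear g).

Lemma dot_norm_le x y : `|dot x y| <= `|x| * `|y|.
Proof.
rewrite -(@ler_pXn2r _ 2)// ?nnegrE ?mulr_ge0//.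
by rewrite exprMn !ell2_norm_sqr real_normK ?num_real// cauchy_schwarz.
Qed.

Lemma dot_continuous g : continuous (dot g : ell2 R -> R^o).
Proof.
apply/linear_bounded_continuous/linear_boundedP.
near=> r => x; apply: le_trans (dot_norm_le g x) _.
by rewrite ler_wpM2r//; near: r; exact: nbhs_pinfty_ge.
Unshelve. all: by end_near. Qed.

Lemma gradient_of_remainder h x g (K : R) :
  (forall v, `|h (x + v) - h x - dot g v| <= K * dot v v) -> is_gradient h x g.
Proof.
move=> hK.
have E : h \o shift x = cst (h x) + (dot g : ell2 R -> R^o) +o_ (0 : ell2 R) id.
  apply/eqaddoP => e e0; near=> v.
  rewrite !fctE /= [v + x]addrC opprD addrA.
  apply: (le_trans (hK v)); rewrite -ell2_norm_sqr expr2 mulrA.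
  apply: ler_wpM2r => //.
  apply: (@le_trans _ _ ((`|K| + 1) * `|v|)).
    by rewrite ler_wpM2r// (le_trans (ler_norm _))// lerDl.
  rewrite mulrC -ler_pdivlMr ?ltr_wpDl//.
  near: v; apply: nbhs0_le; by rewrite divr_gt0// ltr_wpDl.
have d := diff_unique (dot_continuous (g := g)) E.
split; last exact: d.
by apply/diff_locallyP; rewrite d; split => //; exact: dot_continuous.
Unshelve. all: by end_near. Qed.

(** A run may use any vector that is a gradient; uniqueness identifies it with the explicit one. *)
Lemma gradient_unique h x g g' : is_gradient h x g -> is_gradient h x g' -> g = g'.
Proof.
move=> [_ dg] [_ dg']; apply/eqP; rewrite -subr_eq0; apply/eqP/dot_eq0.
rewrite -scaleN1r dotDl dotZl mulN1r.
have /(congr1 (fun F => F (g + -1 *: g'))) : dot g = dot g' by rewrite -dg -dg'.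
by move=> ->; rewrite subrr.
Qed.

End Gradients.

(** * Quadratic functions built from the two flips *)

Section Pencil.
Context {R : realType}.
Implicit Types (a c d : R) (x y v w z : ell2 R).

Lemma ell2DE x y k : (x + y) k = x k + y k. Proof. by []. Qed.
Lemma ell2NE x k : (- x) k = - x k. Proof. by []. Qed.
Lemma ell2ZE a x k : (a *: x) k = a * x k. Proof. by []. Qed.
Lemma flipE b x k : flip b x k = x (flip_index b k). Proof. by []. Qed.
Definition ell2E := (ell2DE, ell2NE, ell2ZE, flipE).

Lemma ell2P x y : (forall k, x k = y k) -> x = y.
Proof. by move=> xy; apply/val_inj/funext. Qed.

(** Each [x - flip b x] is the Laplacian of a matching of the coordinates. For [c = d] the two
    matchings form a path, and the operator is Nesterov's tridiagonal matrix. *)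
Definition pencil a c d x : ell2 R :=
  a *: x + c *: (x - flip false x) + d *: (x - flip true x).

Lemma pencilD a c d x y : pencil a c d (x + y) = pencil a c d x + pencil a c d y.
Proof. by apply: ell2P => k; rewrite /pencil !ell2E; ring. Qed.

Lemma dot_pencilE a c d x y : dot (pencil a c d x) y =
  (a + c + d) * dot x y - c * dot (flip false x) y - d * dot (flip true x) y.
Proof.
rewrite /pencil -!(scaleN1r (flip _ _)) !(dotDl, dotZl); ring.
Qed.

Lemma dot_pencilC a c d x y : dot (pencil a c d x) y = dot x (pencil a c d y).
Proof.
rewrite (dotC x) !dot_pencilE (dotC y x).
by rewrite !(dot_flipC _ x) !(dotC _ x).
Qed.

Lemma dot_pencil_ge a c d x : 0 <= c -> 0 <= d ->
  a * dot x x <= dot (pencil a c d x) x.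
Proof.
move=> c0 d0; rewrite dot_pencilE.
have := dot_flip_bound false x; have := dot_flip_bound true x.
by rewrite !ler_norml => /andP[_ h1] /andP[_ h2]; nra.
Qed.

Lemma norm_pencil a c d x :
  `|pencil a c d x| <= (`|a| + 2 * `|c| + 2 * `|d|) * `|x|.
Proof.
rewrite /pencil; apply: le_trans (ler_normD _ _) _.
rewrite mulrDl mulrDl; apply: lerD; [apply: le_trans (ler_normD _ _) _; apply: lerD|].
- by rewrite normrZ.
- rewrite normrZ -mulrA mulrCA ler_wpM2l//.
  by apply: le_trans (ler_normB _ _) _; rewrite norm_flip; lra.
- rewrite normrZ -mulrA mulrCA ler_wpM2l//.
  by apply: le_trans (ler_normB _ _) _; rewrite norm_flip; lra.
Qed.

Lemma dot_pencil_norm a c d x :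
  `|dot (pencil a c d x) x| <= (`|a| + 2 * `|c| + 2 * `|d|) * dot x x.
Proof.
apply: le_trans (dot_norm_le _ _) _.
by rewrite -ell2_norm_sqr expr2 mulrA ler_wpM2r// norm_pencil.
Qed.

Lemma pencil_lipschitz (K : R) a c d w : `|a| + 2 * `|c| + 2 * `|d| <= K ->
  K.-lipschitz (fun x => pencil a c d x - w).
Proof.
move=> K_ge [x y] _ /=.
have -> : pencil a c d x - w - (pencil a c d y - w) = pencil a c d (x - y).
  by apply: ell2P => k; rewrite /pencil !ell2E; ring.
by apply: le_trans (norm_pencil _ _ _ _) _; rewrite ler_wpM2r.
Qed.

(* A flip is an involution, so (1 - flip)^2 = 2 (1 - flip): a pencil in a single
   flip is inverted within the same family. *)
Lemma pencil_inv a c d : a != 0 -> a + 2 * c != 0 -> a + 2 * d != 0 ->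
  c * d = 0 ->
  cancel (pencil a^-1 (- c / (a * (a + 2 * c))) (- d / (a * (a + 2 * d))))
    (pencil a c d).
Proof.
move=> a0 ac0 ad0 /eqP; rewrite mulf_eq0 => /orP[]/eqP -> x; apply: ell2P => k;
  rewrite /pencil !ell2E !flip_indexK; field; rewrite ?a0 ?ac0 ?ad0//.
Qed.

Definition quadf a c d w x : R^o := 2^-1 * dot (pencil a c d x) x - dot w x.

(** The exact Taylor expansion, from which gradients, convexity and minimality are all read off. *)
Lemma quadf_expand a c d w x v : quadf a c d w (x + v) =
  quadf a c d w x + dot (pencil a c d x - w) v + 2^-1 * dot (pencil a c d v) v.
Proof.
rewrite /quadf pencilD; have := dot_pencilC a c d v x.
move: (pencil a c d x) (pencil a c d v) => px pv pvx.
by rewrite -(scaleN1r w) !(dotDl, dotDr, dotZl) pvx (dotC v); field.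
Qed.

Lemma quadf_gradient a c d w x :
  is_gradient (quadf a c d w) x (pencil a c d x - w).
Proof.
apply: (@gradient_of_remainder _ _ _ _ (2^-1 * (`|a| + 2 * `|c| + 2 * `|d|))) => v.
rewrite quadf_expand.
have -> (p q r : R) : p + q + r - p - q = r by ring.
by rewrite normrM ger0_norm// -mulrA ler_pM2l// dot_pencil_norm.
Qed.

Lemma quadf_smooth (K : R) a c d w : `|a| + 2 * `|c| + 2 * `|d| <= K ->
  smooth K (quadf a c d w).
Proof.
by exists (fun x => pencil a c d x - w);
  [exact: quadf_gradient|exact: pencil_lipschitz].
Qed.

Lemma quadf_strongly_convex a c d w : 0 <= c -> 0 <= d ->
  strongly_convex a (quadf a c d w).
Proof.
move=> c0 d0; exists (fun x => pencil a c d x - w); first exact: quadf_gradient.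
move=> x y; have -> : quadf a c d w y = quadf a c d w (x + (y - x)).
  by rewrite addrC subrK.
rewrite quadf_expand ell2_norm_sqr lerD2l.
by have := @dot_pencil_ge a _ _ (y - x) c0 d0; lra.
Qed.

Lemma quadf_minimizer a c d w x : 0 <= a -> 0 <= c -> 0 <= d ->
  pencil a c d x = w -> is_minimizer (quadf a c d w) x.
Proof.
move=> a0 c0 d0 xw y; have -> : y = x + (y - x) by rewrite addrC subrK.
rewrite quadf_expand xw subrr -(scale0r 0) dotZl mul0r addr0 lerDl.
rewrite mulr_ge0//; apply: le_trans (dot_pencil_ge _ _ c0 d0).
by rewrite mulr_ge0// dot_ge0.
Qed.

Lemma quadf_ge a c d w x y : 0 <= a -> 0 <= c -> 0 <= d ->
  quadf a c d w x + dot (pencil a c d x - w) (y - x) <= quadf a c d w y.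
Proof.
move=> a0 c0 d0; have -> : quadf a c d w y = quadf a c d w (x + (y - x)).
  by rewrite addrC subrK.
rewrite quadf_expand lerDl mulr_ge0//.
by apply: le_trans (dot_pencil_ge _ _ c0 d0); rewrite mulr_ge0// dot_ge0.
Qed.

Lemma quadf_convex a c d w : 0 <= a -> 0 <= c -> 0 <= d ->
  convex_function setT (quadf a c d w).
Proof.
move=> a0 c0 d0 t x y _ _; rewrite convRE.
(* The tangent inequalities at [z] are averaged; their linear parts cancel. *)
pose z : ell2 R := t%:num *: x + (unstable.onem t%:num) *: y.
have -> : conv t x y = z by [].
have t0 : 0 <= t%:num by [].
have t1 : 0 <= unstable.onem t%:num by rewrite unstable.onem_ge0.
have hx := ler_wpM2l t0 (quadf_ge w z x a0 c0 d0).
have hy := ler_wpM2l t1 (quadf_ge w z y a0 c0 d0).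
apply: le_trans (lerD hx hy).
have -> (s r f p q : R) : s * (f + p) + r * (f + q) = (s + r) * f + (s * p + r * q).
  by ring.
rewrite -!dotZr -dotDr.
have -> : t%:num *: (x - z) + unstable.onem t%:num *: (y - z) = 0.
  by apply: ell2P => k; rewrite /z !ell2E /unstable.onem -[RHS]/(0 : R); ring.
by rewrite -(scale0r 0) dotZr mul0r addr0 /unstable.onem addrC subrK mul1r.
Qed.

(** The supremum is attained where the gradient [pencil a c d z - w] equals [y]. *)
Lemma quadf_conjugate a c d w z y : 0 <= a -> 0 <= c -> 0 <= d ->
  pencil a c d z = y + w ->
  convex_conjugate (quadf a c d w) y = (2^-1 * dot z (y + w))%:E.
Proof.
move=> a0 c0 d0 zy.
have attained : dot y z - quadf a c d w z = 2^-1 * dot z (y + w).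
  by rewrite /quadf zy !(dotDl, dotDr) (dotC z y) (dotC z w); field.
apply/eqP; rewrite eq_le; apply/andP; split.
  apply: ge_ereal_sup => _ [x _ <-]; rewrite lee_fin -attained.
  have := quadf_ge w z x a0 c0 d0.
  by rewrite zy addrK -(scaleN1r z) dotDr dotZr; lra.
by apply: ereal_sup_ubound; exists z => //; rewrite attained.
Qed.

(** The conjugate is a quadratic function of the inverse pencil, which involves no flip absent from
    the original one. Hence the conjugate oracle couples no further coordinates. *)
Lemma conjugate_gradient a c d w y g : 0 < a -> 0 <= c -> 0 <= d -> c * d = 0 ->
  is_egradient (convex_conjugate (quadf a c d w)) y g ->
  exists a' c' d', [/\ c = 0 -> c' = 0, d = 0 -> d' = 0 &
     g = pencil a' c' d' (y + w)].
Proof.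
move=> a0 c0 d0 cd0 [_ gradg].
have a'0 : a != 0 by rewrite gt_eqF.
have ac0 : a + 2 * c != 0 by rewrite gt_eqF// ltr_wpDr// mulr_ge0.
have ad0 : a + 2 * d != 0 by rewrite gt_eqF// ltr_wpDr// mulr_ge0.
have inv := pencil_inv a'0 ac0 ad0 cd0.
set a' := a^-1 in inv; set c' := - c / _ in inv; set d' := - d / _ in inv.
exists a', c', d'; split.
- by rewrite /c' => ->; rewrite oppr0 mul0r.
- by rewrite /d' => ->; rewrite oppr0 mul0r.
apply: gradient_unique gradg _.
have -> : fine \o convex_conjugate (quadf a c d w) =
    fun x => quadf a' c' d' 0 (x + w).
  apply/funext => x /=; rewrite (quadf_conjugate (ltW a0) c0 d0 (inv (x + w))) /=.
  by rewrite /quadf -(scale0r 0) dotZl mul0r subr0.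
apply: (@gradient_of_remainder _ _ _ _ (2^-1 * (`|a'| + 2 * `|c'| + 2 * `|d'|))) => v.
rewrite [y + v + w]addrAC (quadf_expand _ _ _ _ (y + w)) subr0.
have -> (p q r : R) : p + q + r - p - q = r by ring.
by rewrite normrM ger0_norm// -mulrA ler_pM2l// dot_pencil_norm.
Qed.

End Pencil.

(** * The sweeping bridge *)

(* During one phase of N.-1 rounds the bridge visits 1, ..., N.-1, upwards in
   even phases and downwards in odd ones. *)
Definition bridge_position (N r : nat) : nat :=
  (if odd (r %/ N.-1) then N.-1 - r %% N.-1 else (r %% N.-1).+1)%N.

(* level N r i bounds the number of coordinates known to node i after r
   rounds.  It is even at node 0 and odd at node N, hence no local computation
   of these two nodes increases it. *)
Definition level (N r i : nat) : nat :=
  ((r %/ N.-1).+1 + (if odd (r %/ N.-1) then bridge_position N r < i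
                     else i < bridge_position N r))%N.

Section Sweep.
Context {N : nat} (N_gt1 : (1 < N)%N).

Let T_gt0 : (0 < N.-1)%N. Proof. by case: N N_gt1 => [|[]]. Qed.

Lemma bridge_position_bounds r : (0 < bridge_position N r < N)%N.
Proof.
by rewrite /bridge_position; have := ltn_pmod r T_gt0; case: ifP; lia.
Qed.

Lemma bridge_position_gt0 r : (0 < bridge_position N r)%N.
Proof. by case/andP: (bridge_position_bounds r). Qed.

Lemma bridge_position_ltN r : (bridge_position N r < N)%N.
Proof. by case/andP: (bridge_position_bounds r). Qed.

Lemma bridge_positionS r :
  [\/ bridge_position N r.+1 = bridge_position N r,
      bridge_position N r.+1 = (bridge_position N r).+1 |
      bridge_position N r = (bridge_position N r.+1).+1].
Proof.
have := ltn_pmod r T_gt0; rewrite /bridge_position divnS// modnS.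
case dv: (N.-1 %| r.+1)%N => h /=.
  (* When a phase ends, the bridge rests for one more round at the extreme position, [N.-1] or 1. *)
  have rT : (r %% N.-1).+1%N = N.-1.
    have : (N.-1 %| (r %% N.-1).+1)%N by rewrite /dvdn -[(_ %% _).+1]addn1 modnDml addn1; exact: dv.
    by move/dvdn_leq => /(_ isT); lia.
  by case: (odd _) => /=; apply: Or31; lia.
by case: (odd _); [apply: Or33|apply: Or32]; lia.
Qed.

Lemma odd_level0 r : odd (level N r 0) = false.
Proof.
rewrite /level; have := bridge_position_gt0 r.
by case: ifP => o h; rewrite ?h ?ltn0 oddD /= o.
Qed.

Lemma odd_levelN r : odd (level N r N).
Proof.
rewrite /level; have := bridge_position_ltN r.
by case: ifP => o h; rewrite ?h 1?[(N < _)%N]ltnNge ?(ltnW h) oddD /= o.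
Qed.

Lemma level_gt0 r i : (0 < level N r i)%N.
Proof. by rewrite /level. Qed.

Lemma level_le r i : (level N r i <= r %/ N.-1 + 2)%N.
Proof. by rewrite /level; case: ifP; lia. Qed.

(** Within a phase the vertices of the higher level lie behind the bridge. They can inform only the
    bridge itself, which is behind the next bridge position. When the phase ends, the base level
    rises by one, which covers every vertex. *)
Lemma level_step r (i j : 'I_N.+1) :
  j = i \/ bridged_heaps N (bridge_position N r) i j ->
  (level N r j <= level N r.+1 i)%N.
Proof.
move=> ij.
have cut : ((j < bridge_position N r)%N -> (i <= bridge_position N r)%N) /\
           ((bridge_position N r < j)%N -> (bridge_position N r <= i)%N).
  case: ij => [->|/bridged_heaps_cut]; first by split; exact: ltnW.
  by apply; [exact: bridge_position_gt0|exact: bridge_position_ltN].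
move: cut; rewrite /level /bridge_position divnS// modnS.
have := ltn_pmod r T_gt0.
case: (N.-1 %| r.+1)%N => h; rewrite /= ?add1n ?add0n.
  by move=> _; case: (odd _) => /=; lia.
by case: (odd _) => -[c1 c2]; lia.
Qed.

(** Only the roots 0 and [N], attached to a new bridge, and the old and new bridges [t] and [t.+1]
    can change parent. *)
Lemma bridge_parent_changed t :
  (#|[set i | bridge_parent_ord N t i != bridge_parent_ord N t.+1 i]%SET| <= 4)%N.
Proof.
pose s : seq 'I_N.+1 := [:: 0; ord_max; inord t; inord t.+1].
apply: (@leq_trans #|[set i in s]%SET|).
  apply: subset_leq_card; apply/fintype.subsetP => i.
  rewrite !finset.inE; apply: contraR; rewrite !negb_or => /and4P[i0 iN it it1].
  have ne (j : nat) : i != inord j -> (j <= N)%N -> (i : nat) != j.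
    by move=> ij jN; apply: contra ij => /eqP <-; rewrite inord_val.
  apply/eqP; rewrite /bridge_parent_ord; congr inord.
  have {}i0 : i != 0%N :> nat by [].
  have {}iN : i != N :> nat by [].
  have ni := ltn_ord i.
  have {}it : (i : nat) != t.
    by have [tN|Nt] := leqP t N; [exact: ne it tN|lia].
  have {}it1 : (i : nat) != t.+1.
    by have [tN|Nt] := leqP t.+1 N; [exact: ne it1 tN|lia].
  rewrite /bridge_parent /left_node /right_node.
  have [lt_it|lt_ti|/eqP] := ltngtP i t; last by rewrite (negbTE it).
    rewrite ifT; last by lia.
    by case E : (_./2) => [|k]//; lia.
  rewrite ifF; last by lia.
  rewrite ifT; last by lia.
  by case E : (_./2) => [|k]//; lia.
by rewrite cardsE; exact: card_size.
Qed.

Lemma sweep_edges_changed r :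
  let E := edges (bridged_heaps N (bridge_position N r)) in
  let E' := edges (bridged_heaps N (bridge_position N r.+1)) in
  (#|((E :\: E') :|: (E' :\: E))%SET| <= 8)%N.
Proof.
rewrite /=; apply: leq_trans (card_parent_edges_changed _ _) _.
rewrite -[8%N]/(2 * 4)%N leq_mul2l /=.
case: (bridge_positionS r) => ->.
- rewrite (_ : [set i | _]%SET = finset.set0) ?cards0//.
  by apply/finset.setP => i; rewrite !finset.inE eqxx.
- exact: bridge_parent_changed.
- rewrite (_ : [set i | _]%SET = [set i | bridge_parent_ord N (bridge_position N r.+1) i
    != bridge_parent_ord N (bridge_position N r.+1).+1 i]%SET).
    exact: bridge_parent_changed.
  by apply/finset.setP => i; rewrite !finset.inE eq_sym.
Qed.

End Sweep.

(** * The chain problem *)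

Section Supported.
Context {R : realType}.
Implicit Types (x w : ell2 R) (m : nat).

Definition supported m : set (ell2 R) := [set x | forall k, (m <= k)%N -> x k = 0].

Lemma supportedW m m' : (m <= m')%N -> supported m `<=` supported m'.
Proof. by move=> mm' x xm k /(leq_trans mm'); exact: xm. Qed.

Lemma supportedD m x y : supported m x -> supported m y -> supported m (x + y).
Proof. by move=> xm ym k mk; rewrite ell2E xm// ym// addr0. Qed.

Lemma supportedZ m (a : R) x : supported m x -> supported m (a *: x).
Proof. by move=> xm k mk; rewrite ell2E xm// mulr0. Qed.

Lemma supported0 m : supported m (0 : ell2 R).
Proof. by []. Qed.

Lemma lspan_supported m (A : set (ell2 R)) :
  A `<=` supported m -> lspan A `<=` supported m.
Proof.
move=> Am _ [n [a [v [vA ->]]]]; elim/big_ind: _ => //.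
- exact: supportedD.
- by move=> i _; apply/supportedZ/Am.
Qed.

(** A prefix of length [m] cuts no pair of [flip b] when [m] has parity [b]. This is what stalls an
    end node until the other one answers. *)
Lemma flip_supported b m x : odd m = b -> supported m x -> supported m (flip b x).
Proof.
move=> mb xm k mk; rewrite flipE xm// /flip_index.
move: mk; rewrite leq_eqVlt => /orP[/eqP <-|].
  by rewrite mb eqxx.
by case: ifP; case: k => //= k _; lia.
Qed.

Lemma pencil_supported a c d m x : (odd m -> c = 0) -> (~~ odd m -> d = 0) ->
  supported m x -> supported m (pencil a c d x).
Proof.
move=> c0 d0 xm; apply: supportedD; first apply: supportedD.
- exact: supportedZ.
- have [/c0 ->|om] := boolP (odd m); first by rewrite scale0r; exact: supported0.
  apply/supportedZ/supportedD => //; rewrite -scaleN1r.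
  by apply/supportedZ/flip_supported => //; exact/negbTE.
- have [om|/d0 ->] := boolP (odd m); last by rewrite scale0r; exact: supported0.
  by apply/supportedZ/supportedD => //; rewrite -scaleN1r; apply/supportedZ/flip_supported.
Qed.

Lemma geometric_square_summable (q : R) : `|q| < 1 ->
  (fun k => q ^+ k) \in @square_summable R.
Proof.
move=> q1; apply/square_summableP.
rewrite (_ : (fun k => _) = geometric 1 (q ^+ 2)); last first.
  by apply/funext => k; rewrite /geometric /= mul1r -!exprM mulnC.
apply: is_cvg_geometric_series.
by rewrite normrX expr_lt1.
Qed.

Definition geometric_ell2 (q : R) (q1 : `|q| < 1) : ell2 R :=
  Ell2 (geometric_square_summable q1).

Fact norm0_lt1 : `|0 : R| < 1. Proof. by rewrite normr0. Qed.

(** The first basis vector, since [0 ^+ 0 = 1]. *)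
Definition unit_ell2 : ell2 R := geometric_ell2 norm0_lt1.

Lemma unit_ell2_supported m : (0 < m)%N -> supported m unit_ell2.
Proof.
by move=> m0 k mk; rewrite /= expr0n gtn_eqF// (leq_trans m0).
Qed.

(** The hypothesis is the characteristic equation of the tridiagonal recurrence, so every row but
    the first vanishes. *)
Lemma pencil_geometric (q mu beta : R) (q1 : `|q| < 1) :
  mu * q = beta * (1 - q) ^+ 2 ->
  pencil mu beta beta (geometric_ell2 q1) =
  (mu + beta * (1 - q)) *: unit_ell2.
Proof.
move=> mq; apply: ell2P => k; rewrite /pencil !ell2E /=.
case: k => [|k]; first by rewrite /= !expr0 expr1 subrr; ring.
rewrite expr0n /= mulr0 /flip_index /=.
have E : mu * q ^+ k.+1 + beta * (q ^+ k.+1 - q ^+ k.+2) +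
    beta * (q ^+ k.+1 - q ^+ k) = (mu * q - beta * (1 - q) ^+ 2) * q ^+ k.
  by rewrite !exprS; ring.
rewrite mq subrr mul0r in E; rewrite -[RHS]E.
by case: (odd k) => //=; rewrite addrAC.
Qed.

(* The flips pair the coordinates 2j, 2j+1 and 2j+1, 2j+2: node 0 holds the
   first kind of links of the chain, node N the second. *)
Definition chain_f (mu g s : R) (N : nat) (i : 'I_N.+1) : ell2 R -> R^o :=
  quadf mu (if i == 0 :> nat then g else 0) (if i == N :> nat then g else 0)
    ((if i == 0 :> nat then s else 0) *: unit_ell2).

Lemma chain_coef_ge0 (g : R) (b : bool) : 0 <= g -> 0 <= (if b then g else 0).
Proof. by case: b. Qed.

Lemma chain_f_convex mu g s N i : 0 <= mu -> 0 <= g ->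
  convex_function setT (@chain_f mu g s N i).
Proof. by move=> mu0 g0; apply: quadf_convex => //; exact: chain_coef_ge0. Qed.

Lemma chain_f_smooth mu g s N i : exists K : R, smooth K (@chain_f mu g s N i).
Proof. by eexists; apply: quadf_smooth; exact: lexx. Qed.

Definition chain_problem (mu g s : R) (N : nat) (mu_ge0 : 0 <= mu)
    (g_ge0 : 0 <= g) (N_gt1 : (1 < N)%N) : problem R :=
  @Problem R N.+1 (fun r => bridged_heaps N (bridge_position N r))
    (@chain_f mu g s N)
    (fun r => bridged_heaps_connected (bridge_position_gt0 N_gt1 r)
                (bridge_position_ltN N_gt1 r))
    (fun i => chain_f_convex s i mu_ge0 g_ge0)
    (chain_f_smooth mu g s (N := N)).

End Supported.

(** * The global objective and the information bound *)

Section ChainProblem.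
Context {R : realType} {mu beta s : R} {N : nat}.
Context (mu_gt0 : 0 < mu) (g_ge0 : 0 <= N.+1%:R * beta) (N_gt1 : (1 < N)%N).
Let DP := chain_problem (N.+1%:R * s) (ltW mu_gt0) g_ge0 N_gt1.

Lemma sum_at_node (a : R) (j : nat) : (j <= N)%N ->
  \sum_(i < N.+1) (if i == j :> nat then a else 0) = a.
Proof.
move=> jN; rewrite -big_mkcond (big_pred1 (inord j))// => i.
by rewrite /= -val_eqE /= inordK.
Qed.

(** The factors [N.+1] held by the end nodes cancel the averaging. *)
Lemma chain_globalE : dp_global DP = quadf mu beta beta (s *: unit_ell2).
Proof.
apply/funext => x; rewrite /dp_global /= /chain_f /quadf.
set D := dot x x; set F := dot (flip false x) x; set G := dot (flip true x) x.
set u := dot unit_ell2 x; set n : R := N.+1%:R.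
have n0 : n != 0 by rewrite pnatr_eq0.
rewrite dot_pencilE dotZl -/D -/F -/G -/u.
transitivity (n^-1 * \sum_(i < N.+1) (2^-1 * mu * D +
    (if i == 0 :> nat then n * beta else 0) * (2^-1 * (D - F)) +
    (if i == N :> nat then n * beta else 0) * (2^-1 * (D - G)) -
    (if i == 0 :> nat then n * s else 0) * u)).
  have E (a b e : R) : 2^-1 * ((mu + a + b) * D - a * F - b * G) - e * u =
      2^-1 * mu * D + a * (2^-1 * (D - F)) + b * (2^-1 * (D - G)) - e * u by ring.
  congr (_ * _); apply: eq_bigr => i _.
  by rewrite dot_pencilE dotZl -/D -/F -/G -/u E.
rewrite sumrB !big_split/= -!mulr_suml !sum_at_node//.
rewrite sumr_const card_ord -mulr_natl -/n.
by field.
Qed.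

(** Communication is handled by [level_step]. A local step changes no support: inner nodes only
    rescale, and the level of an end node has the parity at which its flip preserves the support. *)
Lemma chain_memory_supported (A : first_order_run DP) k i x :
  memory A k i x -> supported (level N (rounds (comm A) k) i) x.
Proof.
elim: k i x => [|k IH] i x; first by rewrite memory0 => ->; exact: supported0.
have roundsS : rounds (comm A) k.+1 = (rounds (comm A) k + comm A k)%N.
  by rewrite /rounds big_ord_recr.
have [cA|cA] := boolP (comm A k).
  move=> /(memory_comm cA); apply: lspan_supported => y [j ij] /IH.
  apply: supportedW; rewrite roundsS cA addn1; apply: level_step => //.
move=> /(memory_local cA); apply: lspan_supported => g [y /IH].
rewrite roundsS (negbTE cA) addn0; set r := rounds _ _ => ym.
have w_supp : supported (level N r i) ((if i == 0 :> nat then N.+1%:R * s else 0) *: unit_ell2).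
  exact/supportedZ/unit_ell2_supported/level_gt0.
have c0 : odd (level N r i) -> (if i == 0 :> nat then N.+1%:R * beta else 0) = 0.
  by case: eqP => // ->; rewrite odd_level0.
have d0 : ~~ odd (level N r i) -> (if i == N :> nat then N.+1%:R * beta else 0) = 0.
  by case: eqP => // ->; rewrite odd_levelN.
case=> [-> //|gradg|gradg].
- rewrite (gradient_unique gradg (quadf_gradient _ _ _ _ _)).
  apply: supportedD; first exact: pencil_supported.
  by rewrite -scaleN1r; exact: supportedZ.
- have [|||a' [c' [d' [c'0 d'0 ->]]]] := conjugate_gradient mu_gt0 _ _ _ gradg.
  + exact: chain_coef_ge0.
  + exact: chain_coef_ge0.
  (* No node is both 0 and [N], so at most one flip coefficient is nonzero. *)
  + case: eqP => [i0|_]; last by rewrite mul0r.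
    by rewrite ifF ?mulr0// i0; apply/negbTE; rewrite eq_sym -lt0n ltnW.
  + apply: pencil_supported; [by move=> /c0|by move=> /d0|exact: supportedD].
Qed.

End ChainProblem.

(** * Condition number and edge changes of the chain problem *)

Section ChainBounds.
Context {R : realType} {mu g : R} (s : R) {N : nat}.
Context (mu_ge0 : 0 <= mu) (g_ge0 : 0 <= g) (N_gt1 : (1 < N)%N).
Let DP := chain_problem s mu_ge0 g_ge0 N_gt1.

Lemma chain_chi_le : dp_chi DP <= 240 * 3 * N.-1%:R.
Proof.
(* The bound is stated in terms of [N.-1], the number of rounds of a phase. *)
have N3 : N.+1%:R <= 3 * N.-1%:R :> R by rewrite -natrM ler_nat; lia.
apply: ge_sup; first by exists (graph_chi R (dp_graph DP 0)); exists 0.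
move=> _ [r _ <-]; rewrite -mulrA; apply: le_trans (ler_wpM2l _ N3); last by [].
apply: graph_chi_bridged_le; first exact: bridge_position_gt0.
exact: bridge_position_ltN.
Qed.

(** In round [m.-1] the bridge stands in the middle, where the spectral gap is known to be small. *)
Lemma chain_chi_ge m : N = m.*2 -> m%:R / 2 <= dp_chi DP.
Proof.
move=> Nm; have m0 : (0 < m)%N by lia.
have pos_m : bridge_position N m.-1 = m.
  have m_lt : (m.-1 < N.-1)%N by lia.
  by rewrite /bridge_position divn_small// modn_small//= prednK.
apply: le_trans (_ : graph_chi R (dp_graph DP m.-1) <= _).
  by rewrite /= pos_m; apply: graph_chi_bridged_ge => //; lia.
apply: ub_le_sup; last by exists m.-1.
exists (240 * N.+1%:R) => _ [r _ <-]; apply: graph_chi_bridged_le.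
  exact: bridge_position_gt0.
exact: bridge_position_ltN.
Qed.

Lemma chain_Delta_le : dp_Delta DP <= 8.
Proof.
apply: ge_sup; first by exists (edges_changed DP 0)%:R; exists 0.
move=> _ [r _ <-]; rewrite -[8]/(8%:R) ler_nat.
exact: sweep_edges_changed.
Qed.

End ChainBounds.

(** * From known coordinates to the number of rounds *)

Lemma supported_far {R : realType} (q : R) (q1 : `|q| < 1) m (x : ell2 R) :
  supported m x -> q ^+ (2 * m) <= `|x - geometric_ell2 q1| ^+ 2.
Proof.
move=> xm; rewrite ell2_norm_sqr.
(* The first unknown coordinate alone already accounts for this error. *)
apply: le_trans (dot_ge_term (x - geometric_ell2 q1) m).
by rewrite !ell2E xm// sub0r sqrrN /= -exprM mulnC.
Qed.

(** Take logarithms and bound ln(1/q) by 1/q - 1. *)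
Lemma ln_geometric_lower {R : realType} (q eps : R) m : 0 < q -> 0 < eps ->
  q ^+ m <= eps -> ln eps^-1 <= m%:R * (q^-1 - 1).
Proof.
move=> q0 eps0 qm.
have : ln eps^-1 <= ln (q^-1 ^+ m).
  by rewrite ler_ln ?posrE ?invr_gt0 ?exprn_gt0 ?invr_gt0// exprVn lef_pV2 ?posrE ?exprn_gt0.
move=> /le_trans; apply; rewrite lnXn ?invr_gt0// -[leLHS]mulr_natl.
rewrite ler_wpM2l//.
have := @le_ln1Dx R (q^-1 - 1); rewrite [1 + _]addrC subrK; apply.
by rewrite ltrBrDl subrr invr_gt0.
Qed.

Lemma exists_large_nat {R : realType} (a b : R) (n : nat) :
  exists m, [/\ (n < m)%N, a < m%:R & b < m%:R].
Proof.
exists (maxn n.+1 (maxn (Num.bound `|a|) (Num.bound `|b|))).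
have boundP (x : R) p : (Num.bound `|x| <= p)%N -> x < p%:R.
  move=> xp; apply: le_lt_trans (ler_norm x) _.
  by apply: lt_le_trans (archi_boundP _) _; rewrite ?ler_nat.
split; first exact: leq_maxl.
  by apply: boundP; rewrite leq_max orbC leq_max leqnn.
by apply: boundP; rewrite leq_max orbC leq_max leqnn orbT.
Qed.

(** Since [l * rk] is at least 128, the additive 2 in [8 * (p + 2)] is absorbed by doubling 8 to
    16. *)
Lemma rounds_arith {R : realFieldType} (A chi T p rho l rk : R) : 0 < A -> 0 <= T ->
  chi <= A * T -> l * rk <= 8 * (p + 2) -> p * T <= rho -> 32 <= l -> 4 <= rk ->
  chi * rk * l <= A * 16 * rho.
Proof.
move=> A0 T0 chi_le p_le rho_ge l32 rk4.
have lr : 32 * 4 <= l * rk by apply: ler_pM.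
have p_ge : l * rk <= 16 * p by lra.
apply: (@le_trans _ _ (A * T * (l * rk))).
  by rewrite -mulrA (mulrC rk) ler_wpM2r//; lra.
apply: (@le_trans _ _ (A * T * (16 * p))).
  by rewrite ler_wpM2l// mulr_ge0// ltW.
have -> : A * T * (16 * p) = A * 16 * (p * T) by ring.
by rewrite ler_wpM2l// mulr_ge0// ltW.
Qed.

Theorem corollary3p2 (R : realType) (alpha c : R)
    (alpha_gt0 : 0 < alpha) (c_gt0 : 0 < c) :
  exists2 C : R, 0 < C &
  forall L mu : R, 0 < mu -> mu <= L -> 24 * mu < L ->
  forall (chi0 : R) (n0 : nat),
  exists (DP : problem R) (xstar : ell2 R),
    [/\ smooth L (dp_global DP),
        strongly_convex mu (dp_global DP),
        is_minimizer (dp_global DP) xstar,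
        chi0 < dp_chi DP &
        (n0 < dp_n DP)%N] /\
    dp_Delta DP <= c * (dp_n DP)%:R `^ alpha /\
    exists2 eps0 : R, 0 < eps0 &
    forall eps : R, 0 < eps -> eps < eps0 ->
    forall (A : first_order_run DP) (k : nat) (i : 'I_(dp_n DP)) (x : ell2 R),
      memory A k i x -> `|x - xstar| ^+ 2 <= eps ->
      C * (dp_chi DP * Num.sqrt (L / mu) * ln (eps^-1)) <=
        (rounds (comm A) k)%:R.
Proof.
(* Here [240 * 3] comes from [chain_chi_le] and 16 from [rounds_arith]; the constant is absolute. *)
have C_gt0 : 0 < (240 * 3 * 16)^-1 :> R by rewrite invr_gt0 -!natrM ltr0n.
exists (240 * 3 * 16)^-1; first exact: C_gt0.
move=> L mu mu0 _ L24 chi0 n0.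
(* The second bound on [m] makes [c * n ^ alpha] at least 8, the maximal number of changed edges. *)
have [m [n0m chi0_lt m_gt]] := exists_large_nat (2 * chi0) ((8 / c) `^ alpha^-1) n0.
have m_gt0 : (0 < m)%N by exact: leq_ltn_trans n0m.
pose N := m.*2.
have N_gt1 : (1 < N)%N by rewrite /N; lia.
have mN : (m <= N.+1)%N by rewrite /N; lia.
pose kappa := L / mu; pose rk := Num.sqrt kappa.
have kappa24 : 24 < kappa by rewrite /kappa ltr_pdivlMr.
have kappa0 : 0 < kappa by lra.
have rk2 : rk ^+ 2 = kappa by rewrite sqr_sqrtr// ltW.
have rk0 : 0 < rk by rewrite sqrtr_gt0.
have rk4 : 4 < rk by nra.
(* A rational choice of the ratio: [beta] is then fixed by the characteristic equation, and
   [4 * beta = mu * (kappa - 2 * rk)] leaves room for [mu] below [L]. The bound [rk > 4] gives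
   [q > 1/2]. *)
pose q := 1 - 2 / rk.
have q_gt : 2^-1 < q.
  by rewrite /q; have : 2 / rk < 2^-1; [rewrite ltr_pdivrMr; lra|lra].
have q_lt1 : q < 1 by rewrite /q ltrBlDr ltrDl divr_gt0.
have q0 : 0 < q by lra.
have q1 : `|q| < 1 by rewrite gtr0_norm.
pose beta := mu * q / (1 - q) ^+ 2.
have betaE : mu * q = beta * (1 - q) ^+ 2.
  by rewrite /beta divfK// sqrf_eq0 gt_eqF// subr_gt0.
have beta0 : 0 < beta.
  by apply: divr_gt0; [exact: mulr_gt0|rewrite exprn_gt0// subr_gt0].
have betaL : mu + 4 * beta <= L.
  have -> : 4 * beta = mu * (kappa - 2 * rk).
    rewrite /beta -rk2 /q; field; rewrite gt_eqF//=; lra.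
  have -> : L = mu * kappa by rewrite /kappa mulrC divfK// gt_eqF.
  nra.
have g_ge0 : 0 <= N.+1%:R * beta by rewrite mulr_ge0// ltW.
pose s := mu + beta * (1 - q).
pose DP := chain_problem (N.+1%:R * s) (ltW mu0) g_ge0 N_gt1.
have chi_le := chain_chi_le (N.+1%:R * s) (ltW mu0) g_ge0 N_gt1; rewrite -/DP in chi_le.
exists DP, (geometric_ell2 q1).
have globalE : dp_global DP = quadf mu beta beta (s *: unit_ell2).
  exact: chain_globalE.
split; first split.
- rewrite globalE; apply: quadf_smooth; rewrite !gtr0_norm//; lra.
- by rewrite globalE; apply: quadf_strongly_convex; exact: ltW.
- rewrite globalE; apply: quadf_minimizer; [exact: ltW..|].
  exact: pencil_geometric.
- apply: lt_le_trans (chain_chi_ge _ _ _ _ (erefl N)).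
  by rewrite ltr_pdivlMr// mulrC.
- exact: leq_trans mN.
split.
  apply: le_trans (chain_Delta_le _ _ _ _) _.
  have n_gt : (8 / c) `^ alpha^-1 <= N.+1%:R.
    by apply: le_trans (ltW m_gt) _; rewrite ler_nat.
  have : 8 / c <= N.+1%:R `^ alpha.
    have -> : 8 / c = ((8 / c) `^ alpha^-1) `^ alpha.
      by rewrite -powRrM mulVf ?gt_eqF// powRr1// divr_ge0// ltW.
    by apply: ge0_ler_powR; rewrite ?nnegrE ?powR_ge0// ltW.
  by rewrite ler_pdivrMr// mulrC.
(* This threshold makes ln(1/eps) at least 32, as [rounds_arith] requires. *)
exists (expR (- 32)); first exact: expR_gt0.
move=> eps eps0 eps_lt A k i x /chain_memory_supported xs x_eps.
set r := rounds _ _.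
(* After [r] rounds no node knows more coordinates than the number of completed phases plus 2. *)
have : q ^+ (2 * (r %/ N.-1 + 2)) <= eps.
  apply: le_trans x_eps; apply: supported_far.
  by apply: supportedW xs; exact: level_le.
move=> /(ln_geometric_lower q0 eps0).
have lneps : 32 <= ln eps^-1.
  rewrite lnV ?posrE// lerNr -(expRK (- 32)) ler_ln ?posrE ?expR_gt0//.
  exact: ltW.
move: (ln eps^-1) lneps => l l32 l_le.
(* Since [q > 1/2], the quotient [(1 - q) / q] is at most [2 * (1 - q)]. *)
have q_inv : q^-1 - 1 <= 4 / rk.
  have -> : q^-1 - 1 = (1 - q) / q by field; rewrite gt_eqF.
  rewrite ler_pdivrMr//; have -> : 1 - q = 2 / rk by rewrite /q; ring.
  have -> : 4 / rk * q = 2 / rk * (2 * q) by ring.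
  by rewrite ler_peMr ?divr_ge0 ?ltW//; lra.
have p_le : l * rk <= 8 * ((r %/ N.-1)%:R + 2).
  have : l <= (2 * (r %/ N.-1 + 2))%:R * (4 / rk).
    by apply: le_trans l_le _; rewrite ler_wpM2l.
  rewrite mulrA ler_pdivlMr// natrM natrD => /le_trans; apply.
  by rewrite le_eqVlt; apply/orP; left; apply/eqP; ring.
have r_ge : (r %/ N.-1)%:R * N.-1%:R <= r%:R :> R.
  by rewrite -natrM ler_nat leq_trunc_div.
move: (dp_chi DP) chi_le => chi chi_le.
rewrite ler_pdivrMl; last by rewrite -!natrM ltr0n.
have A_gt0 : 0 < 240 * 3 :> R by rewrite -natrM ltr0n.
exact: (rounds_arith A_gt0 (ler0n _ _) chi_le p_le r_ge l32 (ltW rk4)).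
Qed.
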